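(* Let $\mathcal H$ be a Hopf algebra with bijective antipode and $A$ a left $\mathcal H$-comodule algebra. Let $(A\natural\mathcal H)_{p,q}=\mathcal H^{\otimes(p+1)}\otimes A^{\otimes(q+1)}$ for $p,q\ge0$, elements written $(g_0,\dots,g_p\mid a_0,\dots,a_q)$, with vertical operators $$\tau(g_0,\dots,g_p\mid a_0,\dots,a_q)=(a_q^{(\bar1)}\cdot(g_0,\dots,g_p)\mid a_q^{(\bar0)},a_0,\dots,a_{q-1}),$$ $$\partial_i(g\mid a)=(g_0,\dots,g_p\mid a_0,\dots,a_ia_{i+1},\dots,a_q)\ (0\le i<q),\quad \partial_q(g\mid a)=(a_q^{(\bar1)}\cdot(g_0,\dots,g_p)\mid a_q^{(\bar0)}a_0,a_1,\dots,a_{q-1}),$$ $$\sigma_i(g\mid a)=(g_0,\dots,g_p\mid a_0,\dots,a_i,1,a_{i+1},\dots,a_q)\ (0\le i\le q),$$ and horizontal operators $$\bar\tau(g_0,\dots,g_p\mid a_0,\dots,a_q)=(S^{-1}(a_0^{(\bar1)}\cdots a_q^{(\bar1)})\cdot g_p,g_0,\dots,g_{p-1}\mid a_0^{(\bar0)},\dots,a_q^{(\bar0)}),$$ $$\bar\partial_i(g\mid a)=(g_0,\dots,g_ig_{i+1},\dots,g_p\mid a_0,\dots,a_q)\ (0\le i<p),$$ $$\bar\partial_p(g\mid a)=\big((S^{-1}(a_0^{(\bar1)}\cdots a_q^{(\bar1)})\cdot g_p)g_0,g_1,\dots,g_{p-1}\mid a_0^{(\bar0)},\dots,a_q^{(\bar0)}\big),$$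 $$\bar\sigma_i(g\mid a)=(g_0,\dots,g_i,1,g_{i+1},\dots,g_p\mid a_0,\dots,a_q)\ (0\le i\le p).$$ Then $A\natural\mathcal H$ with these operators is a cylindrical module.
   Context: $\mathcal H$: Hopf algebra over a commutative ring $k$ with comultiplication $\Delta$, counit $\epsilon$, bijective antipode $S$; Sweedler notation $\Delta^n h=h^{(0)}\otimes\cdots\otimes h^{(n)}$. $A$ is a left $\mathcal H$-comodule algebra: coaction $\rho(a)=a^{(\bar1)}\otimes a^{(\bar0)}$ is a unital algebra map $A\to\mathcal H\otimes A$; iterated coaction $(\Delta^{n-1}\otimes\mathrm{id})\rho(a)=a^{(\bar n)}\otimes\cdots\otimes a^{(\bar1)}\otimes a^{(\bar0)}$. The conjugation action of $\mathcal H$ on itself is $h\cdot g=h^{(0)}gS(h^{(1)})$, and $h\cdot(g_0,\dots,g_p)=(h^{(0)}\cdot g_0,\dots,h^{(p)}\cdot g_p)$. In $a_0^{(\bar1)}\cdots a_q^{(\bar1)}$ each $a_i$ is coacted on separately and the results multiplied in $\mathcal H$. A para-cyclic module is a simplicial $k$-module $(X_n,d_i,s_i)$ with maps $t_n:X_n\to X_n$ satisfying all the relations of a cyclic module except possibly $t_n^{n+1}=\mathrm{id}$. A cylindrical module is a bigraded module $X_{p,q}$ with, for each $q$, a para-cyclic structure $(\bar\partial,\bar\sigma,\bar\tau)$ in the $p$-direction and, for each $p$, a para-cyclic structure $(\partial,\sigma,\tau)$ in the $q$-direction, such that every horizontal operator commutes with every vertical operator and $\bar\tau^{p+1}\tau^{q+1}=\mathrm{id}$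 on each $X_{p,q}$. *)

(* Defs.v *)
(* Tensor products are not available in MathComp, so the
   tensor products  H^{(x)n} (x) A^{(x)m}  are presented as formal sums of pure
   tensors (lists of pairs (g, a) : seq H * seq A, the coefficient being
   absorbed in the first factor) modulo the relation "same image under every
   k-multilinear map into every k-module" -- which is exactly equality in the
   tensor product (universal property). *)
From HB Require Import structures.
From mathcomp Require Import all_boot all_order all_algebra.
Set Implicit Arguments. Unset Strict Implicit. Unset Printing Implicit Defensive.
Import GRing.Theory.
Local Open Scope ring_scope.

(* Generic: para-cyclic and cylindrical modules, for k-modules presented as  *)
(* a carrier V with a "valid element of degree n" predicate and an           *)
(* equality (congruence) eqv n;  addition is ++ (lists), scaling is scl.     *)
Section Generic.
Variables (K : Type) (P : Type) (scl : K -> seq P -> seq P).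
Local Notation V := (seq P).

Definition linmap (validX : V -> Prop) (eqvX : V -> V -> Prop)
  (validY : V -> Prop) (eqvY : V -> V -> Prop) (f : V -> V) : Prop :=
  [/\ (forall l, validX l -> validY (f l)),
      (forall l1 l2, validX l1 -> validX l2 -> eqvX l1 l2 -> eqvY (f l1) (f l2)),
      (forall l1 l2, validX l1 -> validX l2 -> eqvY (f (l1 ++ l2)) (f l1 ++ f l2))
    & (forall c l, validX l -> eqvY (f (scl c l)) (scl c (f l)))].

Definition eqmap (validX : V -> Prop) (eqvY : V -> V -> Prop) (f g : V -> V) :=
  forall l, validX l -> eqvY (f l) (g l).

(* d n i : X_{n+1} -> X_n (i <= n+1),  s n i : X_n -> X_{n+1} (i <= n),
   t n : X_n -> X_n.  All relations of a cyclic module except t^{n+1} = id. *)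
Definition paracyclic (valid : nat -> V -> Prop) (eqv : nat -> V -> V -> Prop)
  (d : nat -> nat -> V -> V) (s : nat -> nat -> V -> V) (t : nat -> V -> V) : Prop :=
  (forall n i, (i <= n.+1)%N ->
     linmap (valid n.+1) (eqv n.+1) (valid n) (eqv n) (d n i)) /\
  (forall n i, (i <= n)%N ->
     linmap (valid n) (eqv n) (valid n.+1) (eqv n.+1) (s n i)) /\
  (forall n, linmap (valid n) (eqv n) (valid n) (eqv n) (t n)) /\
  (forall n i j, (i < j)%N -> (j <= n.+2)%N ->
     eqmap (valid n.+2) (eqv n) (d n i \o d n.+1 j) (d n j.-1 \o d n.+1 i)) /\
  (forall n i j, (i <= j)%N -> (j <= n)%N ->
     eqmap (valid n) (eqv n.+2) (s n.+1 i \o s n j) (s n.+1 j.+1 \o s n i)) /\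
  (forall n i j, (i < j)%N -> (j <= n.+1)%N ->
     eqmap (valid n.+1) (eqv n.+1) (d n.+1 i \o s n.+1 j) (s n j.-1 \o d n i)) /\
  (forall n j, (j <= n)%N ->
     eqmap (valid n) (eqv n) (d n j \o s n j) id /\
     eqmap (valid n) (eqv n) (d n j.+1 \o s n j) id) /\
  (forall n i j, (j.+1 < i)%N -> (i <= n.+2)%N ->
     eqmap (valid n.+1) (eqv n.+1) (d n.+1 i \o s n.+1 j) (s n j \o d n i.-1)) /\
  (forall n i, (1 <= i <= n.+1)%N ->
     eqmap (valid n.+1) (eqv n) (d n i \o t n.+1) (t n \o d n i.-1)) /\
  (forall n, eqmap (valid n.+1) (eqv n) (d n 0 \o t n.+1) (d n n.+1)) /\
  (forall n i, (1 <= i <= n)%N ->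
     eqmap (valid n) (eqv n.+1) (s n i \o t n) (t n.+1 \o s n i.-1)) /\
  (forall n, eqmap (valid n) (eqv n.+1) (s n 0 \o t n) (t n.+1 \o t n.+1 \o s n n)).

(* Bigraded X_{p,q}.  Horizontal (p-direction):  hd p q i : X_{p+1,q} -> X_{p,q},
   hs p q i : X_{p,q} -> X_{p+1,q},  ht p q : X_{p,q} -> X_{p,q}.
   Vertical (q-direction): vd p q i : X_{p,q+1} -> X_{p,q}, etc. *)
Definition cylindrical (valid : nat -> nat -> V -> Prop)
  (eqv : nat -> nat -> V -> V -> Prop)
  (hd hs : nat -> nat -> nat -> V -> V) (ht : nat -> nat -> V -> V)
  (vd vs : nat -> nat -> nat -> V -> V) (vt : nat -> nat -> V -> V) : Prop :=
  (forall q, paracyclic (fun p => valid p q) (fun p => eqv p q)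
                        (fun p i => hd p q i) (fun p i => hs p q i) (fun p => ht p q)) /\
  (forall p, paracyclic (valid p) (eqv p) (vd p) (vs p) (vt p)) /\
  (forall p q i j, (i <= p.+1)%N -> (j <= q.+1)%N ->
     eqmap (valid p.+1 q.+1) (eqv p q) (hd p q i \o vd p.+1 q j) (vd p q j \o hd p q.+1 i)) /\
  (forall p q i j, (i <= p.+1)%N -> (j <= q)%N ->
     eqmap (valid p.+1 q) (eqv p q.+1) (hd p q.+1 i \o vs p.+1 q j) (vs p q j \o hd p q i)) /\
  (forall p q i, (i <= p.+1)%N ->
     eqmap (valid p.+1 q) (eqv p q) (hd p q i \o vt p.+1 q) (vt p q \o hd p q i)) /\
  (forall p q i j, (i <= p)%N -> (j <= q.+1)%N ->
     eqmap (valid p q.+1) (eqv p.+1 q) (hs p q i \o vd p q j) (vd p.+1 q j \o hs p q.+1 i)) /\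
  (forall p q i j, (i <= p)%N -> (j <= q)%N ->
     eqmap (valid p q) (eqv p.+1 q.+1) (hs p q.+1 i \o vs p q j) (vs p.+1 q j \o hs p q i)) /\
  (forall p q i, (i <= p)%N ->
     eqmap (valid p q) (eqv p.+1 q) (hs p q i \o vt p q) (vt p.+1 q \o hs p q i)) /\
  (forall p q j, (j <= q.+1)%N ->
     eqmap (valid p q.+1) (eqv p q) (ht p q \o vd p q j) (vd p q j \o ht p q.+1)) /\
  (forall p q j, (j <= q)%N ->
     eqmap (valid p q) (eqv p q.+1) (ht p q.+1 \o vs p q j) (vs p q j \o ht p q)) /\
  (forall p q, eqmap (valid p q) (eqv p q) (ht p q \o vt p q) (vt p q \o ht p q)) /\
  (forall p q, eqmap (valid p q) (eqv p q) (iter p.+1 (ht p q) \o iter q.+1 (vt p q)) id).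

End Generic.

Section Tensor.
Variables (k : comPzRingType) (H A : algType k).

Definition pt := (seq H * seq A)%type.   (* pure tensor g_0..g_{n-1} | a_0..a_{m-1} *)

Definition multilin (n m : nat) (M : lmodType k) (phi : pt -> M) : Prop :=
  (forall (g : seq H) (a : seq A) i (c : k) (x y : H),
     size g = n -> size a = m -> (i < n)%N ->
     phi (set_nth 0 g i (c *: x + y), a)
       = c *: phi (set_nth 0 g i x, a) + phi (set_nth 0 g i y, a)) /\
  (forall (g : seq H) (a : seq A) i (c : k) (x y : A),
     size g = n -> size a = m -> (i < m)%N ->
     phi (g, set_nth 0 a i (c *: x + y))
       = c *: phi (g, set_nth 0 a i x) + phi (g, set_nth 0 a i y)).

(* equality in H^{(x)n} (x) A^{(x)m} of two formal sums of pure tensors *)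
Definition teq (n m : nat) (l1 l2 : seq pt) : Prop :=
  forall (M : lmodType k) (phi : pt -> M), multilin n m phi ->
    \sum_(x <- l1) phi x = \sum_(x <- l2) phi x.

Definition sclpt (c : k) (x : pt) : pt :=
  match x with
  | (g0 :: g, a) => (c *: g0 :: g, a)
  | ([::], a0 :: a) => ([::], c *: a0 :: a)
  | ([::], [::]) => x
  end.
Definition sclfs (c : k) (l : seq pt) : seq pt := map (sclpt c) l.

Definition ext (f : pt -> seq pt) (l : seq pt) : seq pt := flatten (map f l).

End Tensor.

(* Delta h is given by a representative  sum_x x.1 (x) x.2  (a list),        *)
(* the coaction rho a by a representative  sum_x x.1 (x) x.2  in H (x) A.     *)
Section Hopf.
Variables (k : comPzRingType) (H A : algType k).
Variables (Delta : H -> seq (H * H)) (eps : H -> k) (S Sinv : H -> H).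
Variable (rho : A -> seq (H * A)).

Definition D2 (h : H) : seq (pt H A) := [seq ([:: x.1; x.2], [::] : seq A) | x <- Delta h].
Definition R2 (a : A) : seq (pt H A) := [seq ([:: x.1], [:: x.2]) | x <- rho a].

Definition is_hopf_bijS : Prop :=
  (forall (c : k) (x y : H), teq 2 0 (D2 (c *: x + y)) (sclfs c (D2 x) ++ D2 y)) /\
  (forall h, teq 3 0 [seq ([:: y.1; y.2; x.2], [::] : seq A) | x <- Delta h, y <- Delta x.1]
                    [seq ([:: x.1; y.1; y.2], [::] : seq A) | x <- Delta h, y <- Delta x.2]) /\
  (forall (c : k) (x y : H), eps (c *: x + y) = c * eps x + eps y) /\
  (forall h, \sum_(x <- Delta h) eps x.1 *: x.2 = h) /\
  (forall h, \sum_(x <- Delta h) eps x.2 *: x.1 = h) /\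
  (forall g h, teq 2 0 (D2 (g * h))
                 [seq ([:: x.1 * y.1; x.2 * y.2], [::] : seq A) | x <- Delta g, y <- Delta h]) /\
  teq 2 0 (D2 1) [:: ([:: 1; 1], [::] : seq A)] /\
  (forall g h, eps (g * h) = eps g * eps h) /\ eps 1 = 1 /\
  (forall (c : k) (x y : H), S (c *: x + y) = c *: S x + S y) /\
  (forall h, \sum_(x <- Delta h) S x.1 * x.2 = eps h *: 1) /\
  (forall h, \sum_(x <- Delta h) x.1 * S x.2 = eps h *: 1) /\
  cancel S Sinv /\ cancel Sinv S.

Definition is_comodule_algebra : Prop :=
  (forall (c : k) (x y : A), teq 1 1 (R2 (c *: x + y)) (sclfs c (R2 x) ++ R2 y)) /\
  (forall a, teq 2 1 [seq ([:: y.1; y.2], [:: x.2]) | x <- rho a, y <- Delta x.1]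
                    [seq ([:: x.1; y.1], [:: y.2]) | x <- rho a, y <- rho x.2]) /\
  (forall a, \sum_(x <- rho a) eps x.1 *: x.2 = a) /\
  (forall a b, teq 1 1 (R2 (a * b))
                 [seq ([:: x.1 * y.1], [:: x.2 * y.2]) | x <- rho a, y <- rho b]) /\
  teq 1 1 (R2 1) [:: ([:: 1], [:: 1])].

Fixpoint Dn (n : nat) (h : H) : seq (seq H) :=
  match n with
  | 0 => [:: [:: h]]
  | n'.+1 => flatten [seq [seq y.1 :: y.2 :: behead t | y <- Delta (head 0 t)] | t <- Dn n' h]
  end.

Definition conj (h g : H) : H := \sum_(x <- Delta h) x.1 * g * S x.2.

Definition actt (h : H) (g : seq H) : seq (seq H) :=
  [seq [seq conj y.1 y.2 | y <- zip hs g] | hs <- Dn (size g).-1 h].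

Fixpoint rho_all (a : seq A) : seq (H * seq A) :=
  match a with
  | [::] => [:: (1, [::])]
  | a0 :: a' => [seq (x.1 * y.1, x.2 :: y.2) | x <- rho a0, y <- rho_all a']
  end.

Definition vtau_pt (x : pt H A) : seq (pt H A) :=
  let: (g, a) := x in
  flatten [seq [seq (g', y.2 :: take (size a).-1 a) | g' <- actt y.1 g]
          | y <- rho (last 0 a)].

Definition vd_pt (i : nat) (x : pt H A) : seq (pt H A) :=
  let: (g, a) := x in
  if (i < (size a).-1)%N then
    [:: (g, take i a ++ (nth 0 a i * nth 0 a i.+1) :: drop i.+2 a)]
  else
    flatten [seq [seq (g', (y.2 * head 0 a) :: behead (take (size a).-1 a))
                 | g' <- actt y.1 g]
            | y <- rho (last 0 a)].

Definition vs_pt (i : nat) (x : pt H A) : seq (pt H A) :=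
  let: (g, a) := x in [:: (g, take i.+1 a ++ 1 :: drop i.+1 a)].

Definition htau_pt (x : pt H A) : seq (pt H A) :=
  let: (g, a) := x in
  [seq (conj (Sinv z.1) (last 0 g) :: take (size g).-1 g, z.2) | z <- rho_all a].

Definition hd_pt (i : nat) (x : pt H A) : seq (pt H A) :=
  let: (g, a) := x in
  if (i < (size g).-1)%N then
    [:: (take i g ++ (nth 0 g i * nth 0 g i.+1) :: drop i.+2 g, a)]
  else
    [seq ((conj (Sinv z.1) (last 0 g) * head 0 g) :: behead (take (size g).-1 g), z.2)
    | z <- rho_all a].

Definition hs_pt (i : nat) (x : pt H A) : seq (pt H A) :=
  let: (g, a) := x in [:: (take i.+1 g ++ 1 :: drop i.+1 g, a)].

Definition cvalid (p q : nat) (l : seq (pt H A)) : Prop :=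
  all (fun x => (size x.1 == p.+1) && (size x.2 == q.+1)) l.
Definition ceqv (p q : nat) : seq (pt H A) -> seq (pt H A) -> Prop := teq p.+1 q.+1.

Definition cvd (p q i : nat) := ext (vd_pt i).
Definition cvs (p q i : nat) := ext (vs_pt i).
Definition cvt (p q : nat) := ext vtau_pt.
Definition chd (p q i : nat) := ext (hd_pt i).
Definition chs (p q i : nat) := ext (hs_pt i).
Definition cht (p q : nat) := ext htau_pt.

End Hopf.

(* Main.v *)
(* An identity between maps of tensor products is checked against all
   multilinear maps, so every operator is replaced by its pullback on multilinear
   maps and each identity becomes a Sweedler computation with values in a module.
   In both directions the last face is d_0 t, so only the interior faces and the
   cyclic operators have to be examined. What remains rests on three facts: the
   diagonal conjugation action is an action by algebra maps, the codiagonal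
   coaction of A^{(x)(q+1)} is compatible with products, and S^{-1} is
   anti-multiplicative and anti-comultiplicative (the latter only after acting by
   conjugation). The vertical and horizontal cyclic operators commute because
   S^{-1}(h^(1)) h^(0) and h^(1) S^{-1}(h^(0)) equal eps(h), and
   tau^{q+1} acts by h = a_0^(1)...a_q^(1) while taubar^{p+1} acts by S^{-1}(h). *)
Require Import Defs.
From HB Require Import structures.
From mathcomp Require Import all_boot all_order all_algebra.
From mathcomp Require Import zify.
Set Implicit Arguments. Unset Strict Implicit. Unset Printing Implicit Defensive.
Import GRing.Theory.
Local Open Scope ring_scope.

(** * Para-cyclic and cylindrical modules from interior faces *)

(** Equality of formal sums is only a congruence, so nothing may be rewritten under an operator
    before that operator is known to respect it. The abstract part therefore handles operators
    through [hom], and obtains the mixed relations with a last face by pasting squares. In the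
    concrete part each Sweedler rule holds only for multilinear arguments, and every use leaves
    linearity side conditions for the tactic [lin]. These stay uniform because functions on lists
    are linear in each entry at every length ([slin], [mlin]), and because diagonal actions are
    recursions ([act], [actV]) that receive the rest of the computation as an argument [F]. The two
    cyclic operators behave differently. Each vertical rotation coacts on one new entry of [A], so
    its iterates only multiply elements of [H]. Each horizontal rotation coacts again on all entries
    of [A], so its iterates consume successive legs of a coproduct; the order in which these legs
    arrive is the reason for the reversed recursion [actV]. *)

Section Presented.
Variables (K P : Type) (scl : K -> seq P -> seq P).
Local Notation V := (seq P).

Record obj := Obj { vld : V -> Prop; equ : V -> V -> Prop }.
Implicit Types (X Y Z : obj) (f g h : V -> V).

Definition good X :=
  [/\ forall x, equ X x x, forall x y, equ X x y -> equ X y x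
    & forall x y z, equ X x y -> equ X y z -> equ X x z].

Definition per X x y := [/\ vld X x, vld X y & equ X x y].

(** Equality of the maps that [f] and [g] induce between the quotients; the diagonal case
    [hom X Y f f] says that [f] is well defined on classes. *)
Definition hom X Y (f g : V -> V) := forall x y, per X x y -> per Y (f x) (g y).

Lemma linmap_hom X Y f : linmap scl (vld X) (equ X) (vld Y) (equ Y) f -> hom X Y f f.
Proof. by case=> fv fe _ _ x y [vx vy xy]; split; auto. Qed.

Lemma hom_sym X Y f g : good X -> good Y -> hom X Y f g -> hom X Y g f.
Proof.
move=> [_ sX _] [_ sY _] fg x y [vx vy xy].
by have [] := fg y x; [split; auto | split; auto].
Qed.

Lemma hom_trans X Y f g h : good X -> good Y -> hom X Y f g -> hom X Y g h -> hom X Y f h.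
Proof.
move=> [rX _ _] [_ _ tY] fg gh x y [vx vy xy].
have [v1 _ e1] := fg x x (And3 vx vx (rX x)); have [_ v2 e2] := gh x y (And3 vx vy xy).
by split=> //; apply: tY e1 e2.
Qed.

Lemma hom_comp X Y Z f g f' g' : hom Y Z f g -> hom X Y f' g' -> hom X Z (f \o f') (g \o g').
Proof. by move=> fg fg' x y /fg' /fg. Qed.

Lemma hom_eqmap X Y f g : good X -> hom X Y f g -> eqmap (vld X) (equ Y) f g.
Proof. by move=> [rX _ _] fg x vx; have [] := fg x x (And3 vx vx (rX x)). Qed.

Lemma eqmap_hom X Y f g : good X -> good Y -> eqmap (vld X) (equ Y) f g ->
  hom X Y f f -> hom X Y g g -> hom X Y f g.
Proof.
move=> [rX _ _] [_ _ tY] fg ff gg x y [vx vy xy].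
have [v1 _ _] := ff x x (And3 vx vx (rX x)); have [_ v2 e2] := gg x y (And3 vx vy xy).
by split=> //; apply: tY (fg x vx) e2.
Qed.

Lemma hom_eq X Y f g : (forall x, vld X x -> f x = g x) -> hom X Y f f -> hom X Y f g.
Proof. by move=> fg ff x y xy; have [vx vy _] := xy; rewrite -fg //; apply: ff. Qed.

(** Two commuting squares placed side by side. Since a last face is [d_0] after [t], this transfers
    a commutation from [d_0] and [t] to the last face. *)
Lemma hom_paste X Y Y' Z' f g f' g' h h' h'' :
  good X -> good Z' -> hom X Y f f -> hom Y' Z' g' g' ->
  hom X Y' (h' \o f : V -> V) (f' \o h : V -> V) ->
  hom Y Z' (h'' \o g : V -> V) (g' \o h' : V -> V) ->
  hom X Z' (h'' \o (g \o f)) ((g' \o f') \o h).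
Proof.
move=> gX gZ ff gg sqf sqg.
apply: (@hom_trans _ _ _ (g' \o (h' \o f))) => //; first exact: (hom_comp sqg ff).
exact: (hom_comp gg sqf).
Qed.

(** * Para-cyclic relations deduced from those for interior faces *)

Section Paracyclic.
Variables (X : nat -> obj) (d s : nat -> nat -> V -> V) (t : nat -> V -> V).
Local Notation lin X Y := (linmap scl (vld X) (equ X) (vld Y) (equ Y)).
Local Notation emap X Y := (eqmap (vld X) (equ Y)).
(** The last face enters only through [d_last], an equality of lists and not just a congruence.
    [ds_eqL] and [dtL] are the relations d_{n+1} s_n = id and d_{n+1} t = t d_n with the last face
    replaced by d_0 t. *)
Hypotheses
  (gX : forall n, good (X n))
  (vcat : forall n l1 l2, vld (X n) l1 -> vld (X n) l2 -> vld (X n) (l1 ++ l2))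
  (vscl : forall n c l, vld (X n) l -> vld (X n) (scl c l))
  (lin_d : forall n i, (i <= n)%N -> lin (X n.+1) (X n) (d n i))
  (lin_s : forall n i, (i <= n)%N -> lin (X n) (X n.+1) (s n i))
  (lin_t : forall n, lin (X n) (X n) (t n))
  (d_last : forall n l, vld (X n.+1) l -> d n n.+1 l = d n 0 (t n.+1 l))
  (dd : forall n i j, (i < j <= n.+1)%N ->
     emap (X n.+2) (X n) (d n i \o d n.+1 j) (d n j.-1 \o d n.+1 i))
  (ss : forall n i j, (i <= j <= n)%N ->
     emap (X n) (X n.+2) (s n.+1 i \o s n j) (s n.+1 j.+1 \o s n i))
  (ds_lt : forall n i j, (i < j <= n.+1)%N ->
     emap (X n.+1) (X n.+1) (d n.+1 i \o s n.+1 j) (s n j.-1 \o d n i))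
  (ds_eq : forall n j, (j <= n)%N -> emap (X n) (X n) (d n j \o s n j) id)
  (ds_eqS : forall n j, (j < n)%N -> emap (X n) (X n) (d n j.+1 \o s n j) id)
  (ds_eqL : forall n, emap (X n) (X n) (d n 0 \o (t n.+1 \o s n n)) id)
  (ds_gt : forall n i j, (j.+1 < i <= n.+1)%N ->
     emap (X n.+1) (X n.+1) (d n.+1 i \o s n.+1 j) (s n j \o d n i.-1))
  (dt : forall n i, (1 <= i <= n)%N ->
     emap (X n.+1) (X n) (d n i \o t n.+1) (t n \o d n i.-1))
  (dtL : forall n, emap (X n.+1) (X n) (d n 0 \o (t n.+1 \o t n.+1)) (t n \o d n n))
  (st : forall n i, (1 <= i <= n)%N ->
     emap (X n) (X n.+1) (s n i \o t n) (t n.+1 \o s n i.-1))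
  (st0 : forall n, emap (X n) (X n.+1) (s n 0 \o t n) (t n.+1 \o (t n.+1 \o s n n))).

Lemma hom_t n : hom (X n) (X n) (t n) (t n). Proof. exact: linmap_hom. Qed.
Lemma hom_s n i : (i <= n)%N -> hom (X n) (X n.+1) (s n i) (s n i).
Proof. by move=> ?; apply/linmap_hom/lin_s. Qed.
Lemma hom_d_int n i : (i <= n)%N -> hom (X n.+1) (X n) (d n i) (d n i).
Proof. by move=> ?; apply/linmap_hom/lin_d. Qed.

Lemma hom_lastE n : hom (X n.+1) (X n) (d n 0 \o t n.+1) (d n n.+1).
Proof.
apply: hom_eq => [x vx|]; first by rewrite d_last.
by apply: hom_comp; [apply: hom_d_int | apply: hom_t].
Qed.

Lemma hom_d n i : (i <= n.+1)%N -> hom (X n.+1) (X n) (d n i) (d n i).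
Proof.
rewrite leq_eqVlt => /orP[/eqP->|iN]; last exact: hom_d_int.
apply: (hom_trans (gX _) (gX _) _ (@hom_lastE n)).
exact: (hom_sym (gX _) (gX _) (@hom_lastE n)).
Qed.

Lemma lin_d_all n i : (i <= n.+1)%N -> lin (X n.+1) (X n) (d n i).
Proof.
rewrite leq_eqVlt => /orP[/eqP->|iN]; last exact: lin_d.
have [v0 e0 D0 Z0] := lin_d (leq0n n); have [vt et Dt Zt] := lin_t n.+1.
have [rX sX tX] := gX n.
split=> [l vl|l1 l2 v1 v2 e12|l1 l2 v1 v2|c l vl].
- by rewrite d_last //; auto.
- by rewrite !d_last //; auto.
- rewrite !d_last //; last exact: vcat.
  by apply: tX (D0 _ _ _ _); auto.
- rewrite !d_last //; last exact: vscl.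
  by apply: tX (Z0 _ _ _); auto.
Qed.

Lemma paracyclicI : paracyclic scl (fun n => vld (X n)) (fun n => equ (X n)) d s t.
Proof.
have E n m f g : hom (X n) (X m) f g -> emap (X n) (X m) f g by apply: hom_eqmap.
have hT n m f g h : hom (X n) (X m) f g -> hom (X n) (X m) g h -> hom (X n) (X m) f h.
  exact: hom_trans.
have hS n m f g : hom (X n) (X m) f g -> hom (X n) (X m) g f by apply: hom_sym.
have hE n m f g : emap (X n) (X m) f g -> hom (X n) (X m) f f -> hom (X n) (X m) g g ->
  hom (X n) (X m) f g by apply: eqmap_hom.
have hdt n i : (1 <= i <= n.+1)%N -> hom (X n.+1) (X n) (d n i \o t n.+1) (t n \o d n i.-1).
  move=> /andP[i1 iN]; apply: (hE).
  - move: iN; rewrite leq_eqVlt => /orP[/eqP->|iN]; last by apply: dt; lia.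
    move=> x vx; rewrite /= d_last; first exact: dtL.
    by case: (lin_t n.+1); auto.
  - by apply: hom_comp; [apply: hom_d | apply: hom_t].
  - by apply: hom_comp; [apply: hom_t | apply: hom_d; lia].
have hdd n i j : (i < j <= n.+1)%N ->
    hom (X n.+2) (X n) (d n i \o d n.+1 j) (d n j.-1 \o d n.+1 i).
  move=> ij; apply: (hE); first exact: dd.
  - by apply: hom_comp; apply: hom_d; lia.
  - by apply: hom_comp; apply: hom_d; lia.
have hL n := @hom_lastE n; have hL' n := hS _ _ _ _ (hL n).
split; first exact: lin_d_all.
split; first exact: lin_s.
split; first exact: lin_t.
split.
  move=> n i j ij; rewrite leq_eqVlt => /orP[/eqP jE|jN]; last by apply: dd; lia.
  rewrite {j}jE in ij *; apply: E => /=.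
  (* For i <= n the chain is d_i d_{n+2} = d_i d_0 t = d_0 d_{i+1} t = d_0 t d_i = d_{n+1} d_i; the
     value i = 0 follows the same chain. *)
  have [i0|i0] := posnP i.
    rewrite i0; apply: (hT _ _ _ (d n 0 \o (d n.+1 1 \o t n.+2))).
      apply: (hT _ _ _ (d n 0 \o (d n.+1 0 \o t n.+2))).
        by apply: hom_comp; [apply: hom_d | apply: hL'].
      apply: (@hom_comp _ (X n.+2) _ (d n 0 \o d n.+1 0) (d n 0 \o d n.+1 1)); last exact: hom_t.
      by apply: (hS); apply: (hdd).
    apply: (hT _ _ _ (d n 0 \o (t n.+1 \o d n.+1 0))).
      by apply: hom_comp; [apply: hom_d | apply: (hdt)].
    by apply: (@hom_comp _ (X n.+1) _ (d n 0 \o t n.+1)); [apply: hL | apply: hom_d].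
  have [iN|iN] := leqP i n.
    apply: (hT _ _ _ (d n i \o (d n.+1 0 \o t n.+2))).
      by apply: hom_comp; [apply: hom_d; lia | apply: hL'].
    apply: (hT _ _ _ (d n 0 \o (d n.+1 i.+1 \o t n.+2))).
      apply: (@hom_comp _ (X n.+2) _ (d n i \o d n.+1 0) (d n 0 \o d n.+1 i.+1)); last exact: hom_t.
      by apply: (hS); apply: (hdd).
    apply: (hT _ _ _ (d n 0 \o (t n.+1 \o d n.+1 i))).
      by apply: hom_comp; [apply: hom_d | apply: (hdt)].
    by apply: (@hom_comp _ (X n.+1) _ (d n 0 \o t n.+1)); [apply: hL | apply: hom_d; lia].
  have -> : i = n.+1 by lia.
  (* Here both faces on the left are last ones, and both sides are brought to d_0 d_0 t t: on the
     left d_0 t d_0 t = d_0 d_1 t t, on the right d_0 t d_{n+1} = d_0 d_{n+2} t. *)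
  pose m := d n 0 \o (d n.+1 0 \o (t n.+2 \o t n.+2)).
  apply: (hT _ _ _ m).
    apply: (hT _ _ _ ((d n 0 \o t n.+1) \o (d n.+1 0 \o t n.+2))).
      by apply: hom_comp.
    apply: (hT _ _ _ (d n 0 \o ((d n.+1 1 \o t n.+2) \o t n.+2))).
      apply: (@hom_comp _ (X n.+1) _ (d n 0) _ (t n.+1 \o (d n.+1 0 \o t n.+2))).
        exact: hom_d.
      apply: (@hom_comp _ (X n.+2) _ (t n.+1 \o d n.+1 0) _ (t n.+2)); last exact: hom_t.
      by apply: (hS); apply: (hdt).
    apply: (@hom_comp _ (X n.+2) _ (d n 0 \o d n.+1 1) (d n 0 \o d n.+1 0) (t n.+2 \o t n.+2)).
      exact: hdd.
    by apply: hom_comp; apply: hom_t.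
  apply: (hS); apply: (hT _ _ _ ((d n 0 \o t n.+1) \o d n.+1 n.+1)).
    by apply: hom_comp => //; apply: hom_d.
  apply: (@hom_comp _ (X n.+1) _ (d n 0) _ (t n.+1 \o d n.+1 n.+1)); first exact: hom_d.
  apply: (hT _ _ _ (d n.+1 n.+2 \o t n.+2)); first by apply: (hS); apply: (hdt); lia.
  by apply: (@hom_comp _ (X n.+2) _ _ (d n.+1 0 \o t n.+2) _ (t n.+2)); [apply: (hL') | apply: hom_t].
split; first by move=> n i j ij jn; apply: ss; lia.
split; first by move=> n i j ij jn; apply: ds_lt; lia.
split.
  move=> n j jn; split; first exact: ds_eq.
  move: jn; rewrite leq_eqVlt => /orP[/eqP->|jN]; last exact: ds_eqS.
  move=> x vx; rewrite /= d_last; first exact: ds_eqL.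
  by case: (lin_s (leqnn n)); auto.
split.
  move=> n i j ij; rewrite leq_eqVlt => /orP[/eqP iE|iN]; last by apply: ds_gt; lia.
  rewrite {i}iE in ij *; apply: E => /=.
  (* The chain is d_{n+2} s_j = d_0 t s_j = d_0 s_{j+1} t = s_j d_0 t = s_j d_{n+1}. *)
  have hst : hom (X n.+1) (X n.+2) (s n.+1 j.+1 \o t n.+1) (t n.+2 \o s n.+1 j).
    apply: (hE); first by apply: st; lia.
      by apply: hom_comp; [apply: hom_s; lia | apply: hom_t].
    by apply: hom_comp; [apply: hom_t | apply: hom_s; lia].
  apply: (hT _ _ _ ((d n.+1 0 \o t n.+2) \o s n.+1 j)).
    by apply: hom_comp => //; apply: hom_s; lia.
  apply: (hT _ _ _ (d n.+1 0 \o (s n.+1 j.+1 \o t n.+1))).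
    by apply: (@hom_comp _ (X n.+2) _ (d n.+1 0)); [apply: hom_d | apply: (hS)].
  apply: (hT _ _ _ ((s n j \o d n 0) \o t n.+1)).
    apply: (@hom_comp _ (X n.+1) _ (d n.+1 0 \o s n.+1 j.+1)); last exact: hom_t.
    apply: (hE); first by apply: ds_lt; lia.
      by apply: hom_comp; [apply: hom_d | apply: hom_s; lia].
    by apply: hom_comp; [apply: hom_s; lia | apply: hom_d].
  by apply: (@hom_comp _ (X n) _ (s n j)); [apply: hom_s; lia | apply: hL].
split; first by move=> n i iN; apply/E/hdt.
split; first by move=> n; apply/E/hL.
split; first by move=> n i iN; apply: st.
exact: st0.
Qed.

End Paracyclic.
Ltac hom_op := match goal with H : _ |- hom _ _ _ _ => apply: (H); lia end.
Ltac square e := apply: eqmap_hom; [by [] | by [] | apply: (e); lia | apply: hom_comp; hom_op ..].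

(** * Mixed relations of a cylindrical module deduced from those for interior faces *)

Section Cylindrical.
Variables (X : nat -> nat -> obj) (hd hs vd vs : nat -> nat -> nat -> V -> V)
  (ht vt : nat -> nat -> V -> V).
Local Notation emap X Y := (eqmap (vld X) (equ Y)).
Hypotheses
  (gX : forall p q, good (X p q))
  (hpara : forall q, paracyclic scl (fun p => vld (X p q)) (fun p => equ (X p q))
     (fun p i => hd p q i) (fun p i => hs p q i) (fun p => ht p q))
  (vpara : forall p, paracyclic scl (fun q => vld (X p q)) (fun q => equ (X p q))
     (vd p) (vs p) (vt p))
  (hd_last : forall p q l, vld (X p.+1 q) l -> hd p q p.+1 l = hd p q 0 (ht p.+1 q l))
  (vd_last : forall p q l, vld (X p q.+1) l -> vd p q q.+1 l = vd p q 0 (vt p q.+1 l))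
  (hdvd : forall p q i j, (i <= p)%N -> (j <= q)%N ->
     emap (X p.+1 q.+1) (X p q) (hd p q i \o vd p.+1 q j) (vd p q j \o hd p q.+1 i))
  (hdvs : forall p q i j, (i <= p)%N -> (j <= q)%N ->
     emap (X p.+1 q) (X p q.+1) (hd p q.+1 i \o vs p.+1 q j) (vs p q j \o hd p q i))
  (hdvt : forall p q i, (i <= p)%N ->
     emap (X p.+1 q) (X p q) (hd p q i \o vt p.+1 q) (vt p q \o hd p q i))
  (hsvd : forall p q i j, (i <= p)%N -> (j <= q)%N ->
     emap (X p q.+1) (X p.+1 q) (hs p q i \o vd p q j) (vd p.+1 q j \o hs p q.+1 i))
  (hsvs : forall p q i j, (i <= p)%N -> (j <= q)%N ->
     emap (X p q) (X p.+1 q.+1) (hs p q.+1 i \o vs p q j) (vs p.+1 q j \o hs p q i))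
  (hsvt : forall p q i, (i <= p)%N ->
     emap (X p q) (X p.+1 q) (hs p q i \o vt p q) (vt p.+1 q \o hs p q i))
  (htvd : forall p q j, (j <= q)%N ->
     emap (X p q.+1) (X p q) (ht p q \o vd p q j) (vd p q j \o ht p q.+1))
  (htvs : forall p q j, (j <= q)%N ->
     emap (X p q) (X p q.+1) (ht p q.+1 \o vs p q j) (vs p q j \o ht p q))
  (htvt : forall p q, emap (X p q) (X p q) (ht p q \o vt p q) (vt p q \o ht p q))
  (htvt_id : forall p q, emap (X p q) (X p q) (iter p.+1 (ht p q) \o iter q.+1 (vt p q)) id).

Lemma cylindricalI : cylindrical scl (fun p q => vld (X p q)) (fun p q => equ (X p q))
  hd hs ht vd vs vt.
Proof.
have Hhd p q i : (i <= p.+1)%N -> hom (X p.+1 q) (X p q) (hd p q i) (hd p q i).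
  by move=> iN; apply: linmap_hom; have [+ _] := hpara q; apply.
have Hhs p q i : (i <= p)%N -> hom (X p q) (X p.+1 q) (hs p q i) (hs p q i).
  by move=> iN; apply: linmap_hom; have [_ [+ _]] := hpara q; apply.
have Hht p q : hom (X p q) (X p q) (ht p q) (ht p q).
  by apply: linmap_hom; have [_ [_ [+ _]]] := hpara q; apply.
have Hvd p q i : (i <= q.+1)%N -> hom (X p q.+1) (X p q) (vd p q i) (vd p q i).
  by move=> iN; apply: linmap_hom; have [+ _] := vpara p; apply.
have Hvs p q i : (i <= q)%N -> hom (X p q) (X p q.+1) (vs p q i) (vs p q i).
  by move=> iN; apply: linmap_hom; have [_ [+ _]] := vpara p; apply.
have Hvt p q : hom (X p q) (X p q) (vt p q) (vt p q).
  by apply: linmap_hom; have [_ [_ [+ _]]] := vpara p; apply.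
have vH Y Z f x : good Y -> hom Y Z f f -> vld Y x -> vld Z (f x).
  by move=> [rY _ _] ff vx; have [] := ff x x (And3 vx vx (rY x)).
have Shdvd p q i j : (i <= p)%N -> (j <= q)%N ->
  hom (X p.+1 q.+1) (X p q) (hd p q i \o vd p.+1 q j) (vd p q j \o hd p q.+1 i) by move=> *; square hdvd.
have Shdvs p q i j : (i <= p)%N -> (j <= q)%N ->
  hom (X p.+1 q) (X p q.+1) (hd p q.+1 i \o vs p.+1 q j) (vs p q j \o hd p q i) by move=> *; square hdvs.
have Shdvt p q i : (i <= p)%N ->
  hom (X p.+1 q) (X p q) (hd p q i \o vt p.+1 q) (vt p q \o hd p q i) by move=> *; square hdvt.
have Shsvd p q i j : (i <= p)%N -> (j <= q)%N ->
  hom (X p q.+1) (X p.+1 q) (hs p q i \o vd p q j) (vd p.+1 q j \o hs p q.+1 i) by move=> *; square hsvd.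
have Shsvt p q i : (i <= p)%N ->
  hom (X p q) (X p.+1 q) (hs p q i \o vt p q) (vt p.+1 q \o hs p q i) by move=> *; square hsvt.
have Shtvd p q j : (j <= q)%N ->
  hom (X p q.+1) (X p q) (ht p q \o vd p q j) (vd p q j \o ht p q.+1) by move=> *; square htvd.
have Shtvs p q j : (j <= q)%N ->
  hom (X p q) (X p q.+1) (ht p q.+1 \o vs p q j) (vs p q j \o ht p q) by move=> *; square htvs.
have Shtvt p q : hom (X p q) (X p q) (ht p q \o vt p q) (vt p q \o ht p q) by square htvt.
have Ehdvd p q i : (i <= p)%N -> hom (X p.+1 q.+1) (X p q)
    (hd p q i \o (vd p.+1 q 0 \o vt p.+1 q.+1)) ((vd p q 0 \o vt p q.+1) \o hd p q.+1 i).
  move=> ip; apply: (hom_paste (Y := X p.+1 q.+1) (Y' := X p q.+1) (h' := hd p q.+1 i)) => //;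
    first [exact: Shdvd | exact: Shdvt | hom_op].
have Ehsvd p q i : (i <= p)%N -> hom (X p q.+1) (X p.+1 q)
    (hs p q i \o (vd p q 0 \o vt p q.+1)) ((vd p.+1 q 0 \o vt p.+1 q.+1) \o hs p q.+1 i).
  move=> ip; apply: (hom_paste (Y := X p q.+1) (Y' := X p.+1 q.+1) (h' := hs p q.+1 i)) => //;
    first [exact: Shsvd | exact: Shsvt | hom_op].
have Ehtvd p q : hom (X p q.+1) (X p q)
    (ht p q \o (vd p q 0 \o vt p q.+1)) ((vd p q 0 \o vt p q.+1) \o ht p q.+1).
  apply: (hom_paste (Y := X p q.+1) (Y' := X p q.+1) (h' := ht p q.+1)) => //;
    first [exact: Shtvd | exact: Shtvt | hom_op].
have Evdhd p q j : (j <= q)%N -> hom (X p.+1 q.+1) (X p q)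
    (vd p q j \o (hd p q.+1 0 \o ht p.+1 q.+1)) ((hd p q 0 \o ht p.+1 q) \o vd p.+1 q j).
  move=> jq; apply: (hom_paste (Y := X p.+1 q.+1) (Y' := X p.+1 q) (h' := vd p.+1 q j)) => //;
    first [by apply: hom_sym => //; apply: Shdvd | by apply: hom_sym => //; apply: Shtvd | hom_op].
have Evshd p q j : (j <= q)%N -> hom (X p.+1 q) (X p q.+1)
    (vs p q j \o (hd p q 0 \o ht p.+1 q)) ((hd p q.+1 0 \o ht p.+1 q.+1) \o vs p.+1 q j).
  move=> jq; apply: (hom_paste (Y := X p.+1 q) (Y' := X p.+1 q.+1) (h' := vs p.+1 q j)) => //;
    first [by apply: hom_sym => //; apply: Shdvs | by apply: hom_sym => //; apply: Shtvs | hom_op].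
have Evthd p q : hom (X p.+1 q) (X p q)
    (vt p q \o (hd p q 0 \o ht p.+1 q)) ((hd p q 0 \o ht p.+1 q) \o vt p.+1 q).
  apply: (hom_paste (Y := X p.+1 q) (Y' := X p.+1 q) (h' := vt p.+1 q)) => //;
    first [by apply: hom_sym => //; apply: Shdvt | by apply: hom_sym => //; apply: Shtvt | hom_op].
(* Both faces are last: the squares of the horizontal d_0 and t against the last vertical face,
   obtained above by pasting, are pasted once more. *)
have Ehdvd' p q : hom (X p.+1 q.+1) (X p q)
    ((vd p q 0 \o vt p q.+1) \o (hd p q.+1 0 \o ht p.+1 q.+1))
    ((hd p q 0 \o ht p.+1 q) \o (vd p.+1 q 0 \o vt p.+1 q.+1)).
  apply: (hom_paste (Y := X p.+1 q.+1) (Y' := X p.+1 q)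
    (h' := vd p.+1 q 0 \o vt p.+1 q.+1)) => //;
    first [by apply: hom_sym => //; apply: Ehdvd | by apply: hom_sym => //; apply: Ehtvd | hom_op].
split; first exact: hpara.
split; first exact: vpara.
have hE Y Z f g : good Y -> good Z -> hom Y Z f g -> emap Y Z g f.
  by move=> gY gZ fg; apply: hom_eqmap (hom_sym _ _ fg).
have S x y : (x <= y.+1)%N -> x = y.+1 \/ (x <= y)%N by lia.
split.
  move=> p q i j /S[->|ip] /S[->|jq]; last exact: hdvd.
  - move=> x vx /=; rewrite hd_last; last by apply: vH vx => //; hom_op.
    rewrite !vd_last //; last by apply: vH vx => //; hom_op.
    by rewrite hd_last //; apply: (hE _ _ _ _ _ _ (@Ehdvd' p q)).
  - move=> x vx /=; rewrite !hd_last //; last by apply: vH vx => //; hom_op.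
    exact: (hE _ _ _ _ _ _ (Evdhd p q _ jq)).
  - move=> x vx /=; rewrite !vd_last //; last by apply: vH vx => //; hom_op.
    exact: (hom_eqmap _ (Ehdvd p q _ ip)).
split.
  move=> p q i j /S[->|ip] jq; last exact: hdvs.
  move=> x vx /=; rewrite !hd_last //; last by apply: vH vx => //; hom_op.
  exact: (hE _ _ _ _ _ _ (Evshd p q _ jq)).
split.
  move=> p q i /S[->|ip]; last exact: hdvt.
  move=> x vx /=; rewrite !hd_last //; last by apply: vH vx => //; hom_op.
  exact: (hE _ _ _ _ _ _ (Evthd p q)).
split.
  move=> p q i j ip /S[->|jq]; last exact: hsvd.
  move=> x vx /=; rewrite !vd_last //; last by apply: vH vx => //; hom_op.
  exact: (hom_eqmap _ (Ehsvd p q _ ip)).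
split; first exact: hsvs.
split; first exact: hsvt.
split.
  move=> p q j /S[->|jq]; last exact: htvd.
  move=> x vx /=; rewrite !vd_last //; last by apply: vH vx => //; hom_op.
  exact: (hom_eqmap _ (Ehtvd p q)).
by [].
Qed.

End Cylindrical.
End Presented.

(** * Multilinear maps on lists *)

Section Linear.
Variable k : comPzRingType.
Implicit Types (U V W M N : lmodType k).

(** Wrapping the identity in a constructor keeps a rigid head symbol, on which the tactic [lin] can
    dispatch. *)
Variant lin U V (f : U -> V) : Prop :=
  Lin of forall c x y, f (c *: x + y) = c *: f x + f y.

Lemma linP U V (f : U -> V) : lin f -> forall c x y, f (c *: x + y) = c *: f x + f y.
Proof. by case. Qed.

Lemma linD U V (f : U -> V) x y : lin f -> f (x + y) = f x + f y.
Proof. by move=> /linP/(_ 1 x y); rewrite !scale1r. Qed.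

Lemma lin0 U V (f : U -> V) : lin f -> f 0 = 0.
Proof. by move=> /linP/(_ (-1) 0 0); rewrite scaler0 addr0 scaleN1r addNr. Qed.

Lemma linZ U V (f : U -> V) c x : lin f -> f (c *: x) = c *: f x.
Proof. by move=> fl; have /linP/(_ c x 0) := fl; rewrite !addr0 lin0 // addr0. Qed.

Lemma lin_id U : lin (fun x : U => x).
Proof. by []. Qed.

Lemma eq_lin U V (f g : U -> V) : f =1 g -> lin g -> lin f.
Proof. by move=> fg [gl]; split=> c x y; rewrite !fg. Qed.

Lemma lin_comp U V W (f : V -> W) (t : U -> V) :
  lin f -> lin t -> lin (fun x => f (t x)).
Proof. by move=> fl tl; split=> c x y; rewrite (linP tl) (linP fl). Qed.

Lemma lin_scale U V (a : k) (t : U -> V) : lin t -> lin (fun x => a *: t x).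
Proof.
by move=> tl; split=> c x y; rewrite (linP tl) scalerDr !scalerA mulrC.
Qed.

Lemma lin_mull U (B : algType k) (t : U -> B) b : lin t -> lin (fun x => t x * b).
Proof. by move=> tl; split=> c x y; rewrite (linP tl) mulrDl scalerAl. Qed.

Lemma lin_mulr U (B : algType k) (t : U -> B) b : lin t -> lin (fun x => b * t x).
Proof. by move=> tl; split=> c x y; rewrite (linP tl) mulrDr scalerAr. Qed.

Lemma lin_sum U V I (r : seq I) (f : U -> I -> V) :
  (forall i, lin (f^~ i)) -> lin (fun x => \sum_(i <- r) f x i).
Proof.
move=> fl; split=> c x y; rewrite scaler_sumr -big_split /=.
by apply: eq_bigr => i _; rewrite (linP (fl i)).
Qed.

(* Sweedler sums: when [r] represents a tensor [sum x (x) y] and [f] is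
   bilinear, [bsum r f] is the value at that tensor of the map induced by [f]. *)
Definition bsum X Y M (r : seq (X * Y)) (f : X -> Y -> M) : M :=
  \sum_(z <- r) f z.1 z.2.

Section Bsum.
Variables X Y : Type.
Implicit Type r : seq (X * Y).

Lemma eq_bsum M r (f g : X -> Y -> M) :
  (forall a b, f a b = g a b) -> bsum r f = bsum r g.
Proof. by move=> fg; apply: eq_bigr => z _. Qed.

Lemma lin_bsum U M r (f : U -> X -> Y -> M) :
  (forall a b, lin (fun x => f x a b)) -> lin (fun x => bsum r (f x)).
Proof. by move=> fl; apply: lin_sum => z. Qed.

Lemma bsumC X' Y' M r (s : seq (X' * Y')) (f : X -> Y -> X' -> Y' -> M) :
  bsum r (fun a b => bsum s (f a b)) = bsum s (fun c d => bsum r (fun a b => f a b c d)).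
Proof. exact: exchange_big. Qed.

Lemma bsum_lin M N r (f : X -> Y -> M) (h : M -> N) :
  lin h -> h (bsum r f) = bsum r (fun a b => h (f a b)).
Proof.
move=> hl; rewrite /bsum; elim: r => [|z r ih]; first by rewrite !big_nil lin0.
by rewrite !big_cons (linD _ _ hl) ih.
Qed.

Lemma bsum_scale M r (f : X -> Y -> M) c :
  c *: bsum r f = bsum r (fun a b => c *: f a b).
Proof. exact: scaler_sumr. Qed.

Lemma bsum_mull (B : algType k) r (f : X -> Y -> B) c :
  bsum r f * c = bsum r (fun a b => f a b * c).
Proof. exact: mulr_suml. Qed.

Lemma bsum_mulr (B : algType k) r (f : X -> Y -> B) c :
  c * bsum r f = bsum r (fun a b => c * f a b).
Proof. exact: mulr_sumr. Qed.

End Bsum.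

(** A list with one entry moving linearly and the others fixed. This shape survives consing,
    appending and [rcons], and it is what may be substituted into a function that is linear in each
    entry ([slin_slot]). *)
Variant slot U V (L : U -> seq V) : Prop :=
  Slot s1 s2 (t : U -> V) of lin t & forall x, L x = s1 ++ t x :: s2.

Lemma slot_here U V (t : U -> V) s : lin t -> slot (fun x => t x :: s).
Proof. by move=> tl; apply: (@Slot _ _ _ [::] s t). Qed.

Lemma slot_catl U V (L : U -> seq V) s : slot L -> slot (fun x => s ++ L x).
Proof.
by case=> s1 s2 t tl LE; apply: (@Slot _ _ _ (s ++ s1) s2 t) => // x; rewrite LE catA.
Qed.

Lemma slot_catr U V (L : U -> seq V) s : slot L -> slot (fun x => L x ++ s).
Proof.
by case=> s1 s2 t tl LE; apply: (@Slot _ _ _ s1 (s2 ++ s) t) => // x; rewrite LE -catA.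
Qed.

Lemma slot_cons U V (L : U -> seq V) y : slot L -> slot (fun x => y :: L x).
Proof. exact: (@slot_catl _ _ L [:: y]). Qed.

Lemma slot_rcons U V (L : U -> seq V) y : slot L -> slot (fun x => rcons (L x) y).
Proof.
case/(slot_catr [:: y])=> s1 s2 t tl LE.
by apply: (@Slot _ _ _ s1 s2 t) => // x; rewrite -LE cats1.
Qed.

Lemma slot_last U V (t : U -> V) s : lin t -> slot (fun x => rcons s (t x)).
Proof. by move=> tl; apply: (@Slot _ _ _ s [::] t) => // x; rewrite cats1. Qed.

(** No length is fixed: recursions that shorten or lengthen the list remain within the same
    predicate. *)
Variant slin V M (F : seq V -> M) : Prop :=
  Slin of forall s1 s2, lin (fun x => F (s1 ++ x :: s2)).

Lemma slin_slot U V M (F : seq V -> M) (L : U -> seq V) :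
  slin F -> slot L -> lin (fun x => F (L x)).
Proof.
case=> Fl [s1 s2 t tl LE]; split=> c x y; rewrite !LE.
exact: (linP (lin_comp (Fl s1 s2) tl)).
Qed.

Lemma slinI V M (F : seq V -> M) :
  (forall L : V -> seq V, slot L -> lin (fun x => F (L x))) -> slin F.
Proof. by move=> Fl; split=> s1 s2; apply: Fl; apply: Slot (lin_id V) _. Qed.

Lemma slin_recI V M (F : seq V -> M) :
  (forall s, lin (fun x => F (x :: s))) -> (forall y, slin (fun s => F (y :: s))) ->
  slin F.
Proof.
move=> Fh Ft; split=> -[|y s1] s2 //=.
by apply: (slin_slot (Ft y)); apply: Slot (lin_id V) _.
Qed.

End Linear.

(** * Sweedler calculus *)

Section Hopf.
Variables (k : comPzRingType) (H A : algType k).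
Variables (Delta : H -> seq (H * H)) (eps : H -> k) (S Sinv : H -> H).
Variable (rho : A -> seq (H * A)).
Hypothesis hopf : @is_hopf_bijS k H A Delta eps S Sinv.
Hypothesis coma : @is_comodule_algebra k H A Delta eps rho.
Implicit Types (U M : lmodType k).

Local Notation DS h f := (bsum (Delta h) f).
Local Notation RS a f := (bsum (rho a) f).
Local Notation cj := (conj Delta S).

(** * Hopf and comodule axioms turned into summation rules by testing on functions of few
    variables *)

Lemma multilin20 M (f : H -> H -> M) :
  (forall b, lin (f^~ b)) -> (forall a, lin (f a)) ->
  multilin 2 0 (fun p : pt H A => f p.1`_0 p.1`_1).
Proof.
move=> f1 f2; split=> // -[|g0 [|g1 [|]]] // a [|[|]] // c x y _ _ _ /=.
  exact: (linP (f1 g1)).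
exact: (linP (f2 g0)).
Qed.

Lemma multilin30 M (f : H -> H -> H -> M) :
  (forall b c, lin (fun a => f a b c)) -> (forall a c, lin (fun b => f a b c)) ->
  (forall a b, lin (f a b)) ->
  multilin 3 0 (fun p : pt H A => f p.1`_0 p.1`_1 p.1`_2).
Proof.
move=> f1 f2 f3; split=> // -[|g0 [|g1 [|g2 [|]]]] // a [|[|[|]]] // c x y _ _ _ /=.
- exact: (linP (f1 g1 g2)).
- exact: (linP (f2 g0 g2)).
- exact: (linP (f3 g0 g1)).
Qed.

Lemma multilin11 M (f : H -> A -> M) :
  (forall b, lin (f^~ b)) -> (forall a, lin (f a)) ->
  multilin 1 1 (fun p : pt H A => f p.1`_0 p.2`_0).
Proof.
move=> f1 f2; split=> -[|g0 [|]] // [|a0 [|]] // [|] // c x y _ _ _ /=.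
  exact: (linP (f1 a0)).
exact: (linP (f2 g0)).
Qed.

Lemma multilin21 M (f : H -> H -> A -> M) :
  (forall b c, lin (fun a => f a b c)) -> (forall a c, lin (fun b => f a b c)) ->
  (forall a b, lin (f a b)) ->
  multilin 2 1 (fun p : pt H A => f p.1`_0 p.1`_1 p.2`_0).
Proof.
move=> f1 f2 f3; split=> -[|g0 [|g1 [|]]] // [|a0 [|]] // [|[|]] // c x y _ _ _ /=.
- exact: (linP (f1 g1 a0)).
- exact: (linP (f2 g0 a0)).
- exact: (linP (f3 g0 g1)).
Qed.

Lemma lin_DS U M (t : U -> H) (f : H -> H -> M) :
  lin t -> (forall b, lin (f^~ b)) -> (forall a, lin (f a)) ->
  lin (fun x => DS (t x) f).
Proof.
move=> tl f1 f2; apply: (lin_comp (f := fun h => DS h f)) => //.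
split=> c x y; have [/(_ c x y _ _ (multilin20 f1 f2)) + _] := hopf.
rewrite big_cat /sclfs /D2 !big_map /= /bsum => ->; congr (_ + _).
by rewrite scaler_sumr; apply: eq_bigr => z _; rewrite (linZ _ _ (f1 _)).
Qed.

Lemma DS_assoc M (f : H -> H -> H -> M) h :
  (forall b c, lin (fun a => f a b c)) -> (forall a c, lin (fun b => f a b c)) ->
  (forall a b, lin (f a b)) ->
  DS h (fun a b => DS a (fun a0 a1 => f a0 a1 b)) =
  DS h (fun a b => DS b (fun b0 b1 => f a b0 b1)).
Proof.
move=> f1 f2 f3; have [_ [/(_ h _ _ (multilin30 f1 f2 f3)) + _]] := hopf.
by rewrite !big_allpairs_dep.
Qed.

Lemma lin_epsZ U M (t : U -> H) (v : M) : lin t -> lin (fun x => eps (t x) *: v).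
Proof.
move=> tl; split=> c x y; have [_ [_ [epsl _]]] := hopf.
by rewrite (linP tl) epsl scalerDl scalerA.
Qed.

(** Read from right to left, this rule creates a new tensor leg weighted by [eps], which an antipode
    identity can then expand; most later computations start this way. *)
Lemma DS_counitl M (f : H -> M) h : lin f -> DS h (fun a b => eps a *: f b) = f h.
Proof.
move=> fl; have [_ [_ [_ [/(_ h) e _]]]] := hopf.
rewrite -[in RHS]e -[X in f X]/(bsum (Delta h) (fun a b => eps a *: b)) (bsum_lin _ _ fl).
by apply: eq_bsum => a b; rewrite linZ.
Qed.

Lemma DS_counitr M (f : H -> M) h : lin f -> DS h (fun a b => eps b *: f a) = f h.
Proof.
move=> fl; have [_ [_ [_ [_ [/(_ h) e _]]]]] := hopf.
rewrite -[in RHS]e -[X in f X]/(bsum (Delta h) (fun a b => eps b *: a)) (bsum_lin _ _ fl).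
by apply: eq_bsum => a b; rewrite linZ.
Qed.

Lemma DS_mul M (f : H -> H -> M) g h :
  (forall b, lin (f^~ b)) -> (forall a, lin (f a)) ->
  DS (g * h) f = DS g (fun g0 g1 => DS h (fun h0 h1 => f (g0 * h0) (g1 * h1))).
Proof.
move=> f1 f2; have [_ [_ [_ [_ [_ [/(_ g h _ _ (multilin20 f1 f2)) + _]]]]]] := hopf.
by rewrite !big_allpairs_dep big_map.
Qed.

Lemma DS_1 M (f : H -> H -> M) :
  (forall b, lin (f^~ b)) -> (forall a, lin (f a)) -> DS 1 f = f 1 1.
Proof.
move=> f1 f2; have [_ [_ [_ [_ [_ [_ [/(_ _ _ (multilin20 f1 f2)) + _]]]]]]] := hopf.
by rewrite big_map big_seq1.
Qed.

Lemma epsM g h : eps (g * h) = eps g * eps h.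
Proof. by have [_ [_ [_ [_ [_ [_ [_ []]]]]]]] := hopf. Qed.

Lemma eps1 : eps 1 = 1.
Proof. by have [_ [_ [_ [_ [_ [_ [_ [_ []]]]]]]]] := hopf. Qed.

Lemma lin_S U (t : U -> H) : lin t -> lin (fun x => S (t x)).
Proof.
have [_ [_ [_ [_ [_ [_ [_ [_ [_ [Sl _]]]]]]]]]] := hopf.
exact: (@lin_comp _ _ _ _ S).
Qed.

Lemma DS_antipodel M (f : H -> M) h :
  lin f -> DS h (fun a b => f (S a * b)) = eps h *: f 1.
Proof.
move=> fl; rewrite -linZ //.
have [_ [_ [_ [_ [_ [_ [_ [_ [_ [_ [<- _]]]]]]]]]]] := hopf.
by rewrite [in RHS](bsum_lin (Delta h) (fun a b => S a * b) fl).
Qed.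

Lemma DS_antipoder M (f : H -> M) h :
  lin f -> DS h (fun a b => f (a * S b)) = eps h *: f 1.
Proof.
move=> fl; rewrite -linZ //.
have [_ [_ [_ [_ [_ [_ [_ [_ [_ [_ [_ [<- _]]]]]]]]]]]] := hopf.
by rewrite [in RHS](bsum_lin (Delta h) (fun a b => a * S b) fl).
Qed.

Lemma SK : cancel S Sinv.
Proof. by have [_ [_ [_ [_ [_ [_ [_ [_ [_ [_ [_ [_ []]]]]]]]]]]]] := hopf. Qed.

Lemma SinvK : cancel Sinv S.
Proof. by have [_ [_ [_ [_ [_ [_ [_ [_ [_ [_ [_ [_ []]]]]]]]]]]]] := hopf. Qed.

Lemma lin_Sinv U (t : U -> H) : lin t -> lin (fun x => Sinv (t x)).
Proof.
apply: (@lin_comp _ _ _ _ Sinv); split=> c x y.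
by apply: (can_inj SK); rewrite SinvK (linP (lin_S (lin_id H))) !SinvK.
Qed.

Lemma lin_cjl U (t : U -> H) g : lin t -> lin (fun x => cj (t x) g).
Proof.
move=> tl; apply: (lin_DS (f := fun a b => a * g * S b)) => // b.
  by do 2!apply: lin_mull.
exact: lin_mulr (lin_S (lin_id H)).
Qed.

Lemma lin_cjr U (t : U -> H) h : lin t -> lin (fun x => cj h (t x)).
Proof. by move=> tl; apply: lin_sum => z; apply/lin_mull/lin_mulr. Qed.

Lemma cjE h x : cj h x = DS h (fun a b => a * x * S b).
Proof. by []. Qed.

Lemma cj_bsum X Y r (f : X -> Y -> H) h :
  cj h (bsum r f) = bsum r (fun a b => cj h (f a b)).
Proof. exact: bsum_lin (lin_cjr h (lin_id H)). Qed.

Lemma lin_RS U M (t : U -> A) (f : H -> A -> M) :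
  lin t -> (forall b, lin (f^~ b)) -> (forall a, lin (f a)) ->
  lin (fun x => RS (t x) f).
Proof.
move=> tl f1 f2; apply: (lin_comp (f := fun h => RS h f)) => //.
split=> c x y; have [/(_ c x y _ _ (multilin11 f1 f2)) + _] := coma.
rewrite big_cat /sclfs /R2 !big_map /= /bsum => ->; congr (_ + _).
by rewrite scaler_sumr; apply: eq_bigr => z _; rewrite (linZ _ _ (f1 _)).
Qed.

Lemma RS_assoc M (f : H -> H -> A -> M) x :
  (forall b c, lin (fun a => f a b c)) -> (forall a c, lin (fun b => f a b c)) ->
  (forall a b, lin (f a b)) ->
  RS x (fun h x0 => RS x0 (fun h' x1 => f h h' x1)) =
  RS x (fun h x0 => DS h (fun h0 h1 => f h0 h1 x0)).
Proof.
move=> f1 f2 f3; have [_ [/(_ x _ _ (multilin21 f1 f2 f3)) + _]] := coma.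
by rewrite !big_allpairs_dep => /esym.
Qed.

Lemma RS_counit M (f : A -> M) x : lin f -> RS x (fun h x0 => eps h *: f x0) = f x.
Proof.
move=> fl; have [_ [_ [/(_ x) e _]]] := coma.
rewrite -[in RHS]e -[X in f X]/(bsum (rho x) (fun a b => eps a *: b)) (bsum_lin _ _ fl).
by apply: eq_bsum => a b; rewrite linZ.
Qed.

Lemma RS_mul M (f : H -> A -> M) x y :
  (forall b, lin (f^~ b)) -> (forall a, lin (f a)) ->
  RS (x * y) f = RS x (fun g x0 => RS y (fun h y0 => f (g * h) (x0 * y0))).
Proof.
move=> f1 f2; have [_ [_ [_ [/(_ x y _ _ (multilin11 f1 f2)) + _]]]] := coma.
by rewrite !big_allpairs_dep big_map.
Qed.

Lemma RS_1 M (f : H -> A -> M) :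
  (forall b, lin (f^~ b)) -> (forall a, lin (f a)) -> RS 1 f = f 1 1.
Proof.
move=> f1 f2; have [_ [_ [_ [_ /(_ _ _ (multilin11 f1 f2))]]]] := coma.
by rewrite big_map big_seq1.
Qed.

Ltac lin_hyp H :=
  first [ apply: (lin_comp H) | apply: (lin_comp (H _)) | apply: (lin_comp (H _ _))
        | apply: (lin_comp (H _ _ _))
        | apply: (slin_slot H) | apply: (slin_slot (H _)) | apply: (slin_slot (H _ _)) ].

(** A hook, redefined by [::=] as soon as linearity of the list actions and coactions is proved, so
    that [lin] covers them too. *)
Ltac lin_more := fail.
Ltac lin_core := idtac; match goal with
  | |- forall _, _ => intro
  | |- lin (fun x => x) => exact: lin_id
  | |- lin _ => first
    [ exact: lin_id
    | apply: lin_scale | apply: lin_epsZ | apply: lin_mull | apply: lin_mulr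
    | apply: lin_S | apply: lin_Sinv | apply: lin_cjl | apply: lin_cjr
    | apply: lin_DS | apply: lin_RS | apply: lin_bsum ]
  | |- lin _ => lin_more
  | H : _ |- lin _ => lin_hyp H
  | |- slin _ => apply: slinI
  | |- slot _ => first
    [ eassumption | apply: slot_cons | apply: slot_here | apply: slot_catr | apply: slot_catl
    | apply: slot_rcons | apply: slot_last ]
  end.
Ltac lin := repeat lin_core.

(** * Identities for the antipode, its inverse and conjugation *)

Lemma S1 : S 1 = 1.
Proof.
have := @DS_antipodel _ (fun x => x) 1 (lin_id H).
by rewrite DS_1 ?mulr1 ?eps1 ?scale1r //; lin.
Qed.

(** Uniqueness of convolution inverses: both sides, as functions of g and h, are inverse to the
    multiplication map. *)
Lemma SM g h : S (g * h) = S h * S g.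
Proof.
(* [X] is the triple convolution of S(gh), the product gh and S(h)S(g). Contracting its two right
   factors gives S(gh), contracting its two left factors gives S(h)S(g). *)
pose X := DS g (fun g0 g' => DS h (fun h0 h' => DS g' (fun g1 g2 => DS h' (fun h1 h2 =>
   S (g0 * h0) * (g1 * h1) * (S h2 * S g2))))).
transitivity X.
  rewrite -(@DS_counitr _ (fun x => S (x * h))); last by lin.
  apply: eq_bsum => g0 g'; rewrite -(@DS_counitr _ (fun y => S (g0 * y)) h); last by lin.
  rewrite bsum_scale; apply: eq_bsum => h0 h'.
  transitivity (DS g' (fun g1 g2 => eps h' *: (S (g0 * h0) * (g1 * S g2)))); last first.
    apply: eq_bsum => g1 g2; rewrite mulrA.
    rewrite -[in LHS](mulr1 g1) mulrA.
    rewrite -(@DS_antipoder _ (fun y => S (g0 * h0) * g1 * y * S g2)); last by lin.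
    by apply: eq_bsum => h1 h2; rewrite !mulrA.
  rewrite (@DS_antipoder _ (fun y => eps h' *: (S (g0 * h0) * y))); last by lin.
  by rewrite mulr1.
transitivity (DS g (fun a g2 => DS a (fun g0 g1 => DS h (fun b h2 => DS b (fun h0 h1 =>
   S (g0 * h0) * (g1 * h1) * (S h2 * S g2)))))).
  rewrite [in RHS]DS_assoc; [|lin..].
  apply: eq_bsum => g0 g'; rewrite bsumC; apply: eq_bsum => g1 g2.
  by rewrite [in RHS]DS_assoc; [|lin..].
rewrite -[RHS](@DS_counitl _ (fun x => S h * S x)); last by lin.
apply: eq_bsum => a g2; rewrite bsumC -(@DS_counitl _ S h); last by lin.
rewrite bsum_mull bsum_scale.
apply: eq_bsum => b h2.
transitivity (DS (a * b) (fun u v => S u * v * (S h2 * S g2))); last first.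
  rewrite (@DS_antipodel _ (fun y => y * (S h2 * S g2))); last by lin.
  by rewrite mul1r epsM -scalerAl scalerA.
by rewrite DS_mul; [|by lin..].
Qed.

Lemma SinvM g h : Sinv (g * h) = Sinv h * Sinv g.
Proof. by apply: (can_inj SK); rewrite SM !SinvK. Qed.

Lemma Sinv1 : Sinv 1 = 1.
Proof. by rewrite -{1}S1 SK. Qed.

(** The antipode axiom pushed through [Sinv]: reversing the product S(h^(0)) h^(1) gives
    S^{-1}(h^(1)) h^(0). *)
Lemma DS_Sinvl M (f : H -> M) h :
  lin f -> DS h (fun a b => f (Sinv b * a)) = eps h *: f 1.
Proof.
move=> fl; rewrite -[X in f X]Sinv1.
rewrite -(@DS_antipodel _ (fun x => f (Sinv x))); last by lin.
by apply: eq_bsum => a b; rewrite SinvM SK.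
Qed.

Lemma DS_Sinvr M (f : H -> M) h :
  lin f -> DS h (fun a b => f (b * Sinv a)) = eps h *: f 1.
Proof.
move=> fl; rewrite -[X in f X]Sinv1.
rewrite -(@DS_antipoder _ (fun x => f (Sinv x))); last by lin.
by apply: eq_bsum => a b; rewrite SinvM SK.
Qed.

(** Apply [eps] to S^{-1}(h^(1)) h^(0) = eps(h): multiplicativity and the counit axiom turn the left
    side into eps(S^{-1}(h)). The ring is viewed as the module [k^o] so that [eps] can serve as a
    linear argument. *)
Lemma eps_Sinv h : eps (Sinv h) = eps h.
Proof.
have epsl : lin (eps : H -> k^o) by have [_ [_ [ep _]]] := hopf; split.
have := @DS_Sinvl _ (eps : H -> k^o) h epsl.
rewrite eps1 -[RHS]/(eps h * 1) mulr1 => <-.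
rewrite -[LHS](@DS_counitl _ (fun x => eps (Sinv x) : k^o)); last by lin.
by apply: (@eq_bsum k H H k^o) => a b; rewrite epsM mulrC.
Qed.

Lemma cjM g h x : cj (g * h) x = cj g (cj h x).
Proof.
rewrite [LHS](DS_mul (f := fun a b => a * x * S b)); [|by lin..].
rewrite [cj h x]cjE cj_bsum bsumC; apply: eq_bsum => h0 h1.
rewrite cjE; apply: eq_bsum => g0 g1.
by rewrite SM !mulrA.
Qed.

Lemma cj1l x : cj 1 x = x.
Proof.
by rewrite [LHS](DS_1 (f := fun a b => a * x * S b)) ?S1 ?mul1r ?mulr1 //; lin.
Qed.

Lemma cj1r h : cj h 1 = eps h *: 1.
Proof.
rewrite cjE -(DS_antipoder _ (lin_id H)).
by apply: eq_bsum => a b; rewrite mulr1.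
Qed.

(** On the right four legs appear as h^(0) x S(h^(1)) h^(2) y S(h^(3)), and the two middle ones
    cancel by the antipode axiom. *)
Lemma cj_prod h x y : cj h (x * y) = DS h (fun a b => cj a x * cj b y).
Proof.
transitivity (DS h (fun a b => DS a (fun a0 a1 => DS b (fun b0 b1 =>
   a0 * x * S a1 * b0 * y * S b1)))).
  rewrite DS_assoc; [|by lin..].
  rewrite [LHS]cjE; apply: eq_bsum => a b.
  rewrite -(DS_assoc (f := fun a1 b0 b1 => a * x * S a1 * b0 * y * S b1)); [|by lin..].
  rewrite -(DS_counitl (f := fun b => a * (x * y) * S b)); last by lin.
  apply: eq_bsum => c b1.
  transitivity (DS c (fun a1 b0 => a * x * (S a1 * b0) * y * S b1)); last first.
    by apply: eq_bsum => a1 b0; rewrite !mulrA.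
  rewrite (DS_antipodel (f := fun u => a * x * u * y * S b1)); last by lin.
  by rewrite mulr1 !mulrA.
apply: eq_bsum => a b.
rewrite [cj a x]cjE bsum_mull; apply: eq_bsum => a0 a1.
rewrite [cj b y]cjE bsum_mulr; apply: eq_bsum => b0 b1.
by rewrite !mulrA.
Qed.

(* [Sinv] reverses comultiplication; instead of proving this in the tensor
   square, both sides are compared after acting by a further tensor leg. *)
Lemma cjV_prod h x y :
  cj (Sinv h) (x * y) = DS h (fun a b => cj (Sinv b) x * cj (Sinv a) y).
Proof.
pose G h := DS h (fun a b => cj (Sinv b) x * cj (Sinv a) y).
have Gl : lin G by rewrite /G; lin.
rewrite -/(G h).
(* Acting by h^(1) on G(h^(0)) produces legs a0, a1, b0, b1 in this order. The inner pair b0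
   S^{-1}(a1) cancels on x, which makes b1 and S^{-1}(a0) adjacent, and these cancel on y. *)
have key h' : DS h' (fun a b => cj b (G a)) = eps h' *: (x * y).
  transitivity (DS h' (fun a b => DS a (fun a0 a1 => DS b (fun b0 b1 =>
      cj (b0 * Sinv a1) x * cj (b1 * Sinv a0) y)))).
    apply: eq_bsum => a b.
    rewrite /G cj_bsum; apply: eq_bsum => a0 a1.
    by rewrite cj_prod; apply: eq_bsum => b0 b1; rewrite !cjM.
  rewrite DS_assoc; [|by lin..].
  transitivity (DS h' (fun a b => x * cj (b * Sinv a) y)); last first.
    rewrite (DS_Sinvr (f := fun u => x * cj u y)); last by lin.
    by rewrite cj1l.
  apply: eq_bsum => a b.
  rewrite -(DS_assoc (f := fun a1 b0 b1 => cj (b0 * Sinv a1) x * cj (b1 * Sinv a) y));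
    [|by lin..].
  rewrite -(DS_counitl (f := fun b => x * cj (b * Sinv a) y)); last by lin.
  apply: eq_bsum => c b1.
  rewrite (DS_Sinvr (f := fun u => cj u x * cj (b1 * Sinv a) y)); last by lin.
  by rewrite cj1l.
(* With [key] read backwards, eps(h^(0)) xy becomes an action on [G]; the factor S^{-1}(h^(2)) h^(1)
   that then precedes G(h^(0)) is a counit, leaving [G h]. *)
rewrite -(DS_counitl (f := fun h => cj (Sinv h) (x * y))); last by lin.
transitivity (DS h (fun a b => DS a (fun a0 a1 => cj (Sinv b) (cj a1 (G a0))))).
  apply: eq_bsum => a b; rewrite -cj_bsum key.
  by rewrite (linZ _ _ (lin_cjr (Sinv b) (lin_id H))).
rewrite DS_assoc; [|by lin..].
rewrite -(DS_counitr (f := G)) //; apply: eq_bsum => a b.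
rewrite -{2}[G a]cj1l -(DS_Sinvl (f := fun u => cj u (G a))); last by lin.
by apply: eq_bsum => b0 b1; rewrite cjM.
Qed.

Lemma cjV1r h : cj (Sinv h) 1 = eps h *: 1.
Proof. by rewrite cj1r eps_Sinv. Qed.

(** * Diagonal action and codiagonal coaction *)

(** The value of [F] at the diagonal action of [h] on the tensor [g]. One leg is split off for each
    entry, and [eps] removes the leg left over at the end, so that the empty list needs no special
    treatment; [actE] identifies this with [actt]. *)
Fixpoint act M (h : H) (g : seq H) (F : seq H -> M) : M :=
  if g is x :: g' then DS h (fun h0 h1 => act h1 g' (fun l => F (cj h0 x :: l)))
  else eps h *: F [::].

Local Notation rA a f := (bsum (rho_all rho a) f).

Lemma eq_act M h g (F G : seq H -> M) :
  (forall l, size l = size g -> F l = G l) -> act h g F = act h g G.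
Proof.
elim: g h F G => [|x g ih] h F G FG /=; first by rewrite FG.
by apply: eq_bsum => h0 h1; apply: ih => l ls; rewrite FG //= ls.
Qed.

Lemma lin_actF U M h g (F : U -> seq H -> M) :
  (forall l, lin (fun x => F x l)) -> lin (fun x => act h g (F x)).
Proof.
elim: g h F => [|y g ih] h F Fl /=; first by lin.
by apply: lin_bsum => a b; apply: ih.
Qed.

Lemma act_bsum X Y M (r : seq (X * Y)) h g (F : seq H -> X -> Y -> M) :
  act h g (fun l => bsum r (F l)) = bsum r (fun a b => act h g (fun l => F l a b)).
Proof.
elim: g h F => [|y g ih] h F /=; first by rewrite bsum_scale.
rewrite [RHS]bsumC; apply: eq_bsum => a b; exact: (ih _ (fun l => F (cj a y :: l))).
Qed.

Lemma lin_actl U M (t : U -> H) g (F : seq H -> M) :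
  lin t -> slin F -> lin (fun x => act (t x) g F).
Proof.
elim: g U t F => [|y g ih] U t F tl Fl /=; first by lin.
apply: lin_DS => // [b|a]; first by apply: lin_actF; lin.
by apply: ih; lin.
Qed.

Lemma lin_actr U M h (L : U -> seq H) (F : seq H -> M) :
  slot L -> slin F -> lin (fun x => act h (L x) F).
Proof.
move=> Ll Fl; apply: (slin_slot (F := fun g => act h g F)) => //; split.
move=> s1 s2; elim: s1 h F Fl => [|y s1 ih] h F Fl /=.
  by apply: lin_bsum => a b; apply: lin_actF; lin.
by apply: lin_bsum => a b; apply: ih; lin.
Qed.

Lemma rA_nil M (F : H -> seq A -> M) : rA [::] F = F 1 [::].
Proof. by rewrite /bsum big_seq1. Qed.

Lemma rA_cons M x a (F : H -> seq A -> M) :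
  rA (x :: a) F = RS x (fun h0 x0 => rA a (fun h a' => F (h0 * h) (x0 :: a'))).
Proof. by rewrite /bsum /= big_allpairs_dep. Qed.

Lemma eq_rA M a (F G : H -> seq A -> M) :
  (forall h a', size a' = size a -> F h a' = G h a') -> rA a F = rA a G.
Proof.
elim: a F G => [|x a ih] F G FG; first by rewrite !rA_nil FG.
rewrite !rA_cons; apply: eq_bsum => h0 x0; apply: ih => h a' sa.
by rewrite FG //= sa.
Qed.

Lemma lin_rA U M (L : U -> seq A) (F : H -> seq A -> M) :
  slot L -> (forall a, lin (F^~ a)) -> (forall h, slin (F h)) ->
  lin (fun x => rA (L x) F).
Proof.
move=> Ll F1 F2; apply: (slin_slot (F := fun a => rA a F)) => //; split.
move=> s1 s2; elim: s1 F F1 F2 => [|y s1 ih] F F1 F2 /=.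
  by apply: (eq_lin (fun x => rA_cons x s2 F)); lin.
apply: (eq_lin (fun x => rA_cons y _ F)).
by apply: lin_bsum => h0 x0; apply: ih; lin.
Qed.

Ltac lin_more ::= first [apply: lin_actl | apply: lin_actr | apply: lin_actF | apply: lin_rA].

Definition face (R : pzSemiRingType) i (l : seq R) : seq R :=
  take i l ++ (l`_i * l`_i.+1) :: drop i.+2 l.
Definition ins1 (R : pzSemiRingType) i (l : seq R) : seq R := take i l ++ 1 :: drop i l.
Arguments face : simpl never.
Arguments ins1 : simpl never.

Lemma act_M M g h l (F : seq H -> M) : slin F ->
  act h l (fun l' => act g l' F) = act (g * h) l F.
Proof.
elim: l g h F => [|x l ih] g h F Fl /=; first by rewrite scalerA epsM mulrC.
rewrite DS_mul; [|by lin..].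
transitivity (DS h (fun h0 h1 => DS g (fun g0 g1 => act h1 l (fun l' =>
   act g1 l' (fun l'' => F (cj g0 (cj h0 x) :: l'')))))).
  by apply: eq_bsum => h0 h1; rewrite act_bsum.
rewrite bsumC; apply: eq_bsum => g0 g1; apply: eq_bsum => h0 h1.
by rewrite ih ?cjM //; lin.
Qed.

Lemma act_1 M g (F : seq H -> M) : slin F -> act 1 g F = F g.
Proof.
elim: g F => [|x g ih] F Fl /=; first by rewrite eps1 scale1r.
by rewrite DS_1; [rewrite ih ?cj1l //; lin|lin..].
Qed.

(** The recursion of [act] peels entries from the front, while cyclic operators work on the last
    entry; coassociativity connects the two. *)
Lemma act_rcons M h g x (F : seq H -> M) : slin F ->
  act h (rcons g x) F = DS h (fun h0 h1 => act h0 g (fun l => F (rcons l (cj h1 x)))).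
Proof.
elim: g h F => [|y g ih] h F Fl /=.
  rewrite (DS_counitr (f := fun u => F [:: cj u x])); last by lin.
  by rewrite (DS_counitl (f := fun u => F [:: cj u x])); last by lin.
rewrite DS_assoc; [|by lin..].
by apply: eq_bsum => h0 h1; rewrite ih; [|by lin].
Qed.

Lemma face0 (R : pzSemiRingType) (x y : R) l : face 0 [:: x, y & l] = x * y :: l.
Proof. by rewrite /face /= drop0. Qed.

Lemma faceS (R : pzSemiRingType) i (x : R) l : face i.+1 (x :: l) = x :: face i l.
Proof. by []. Qed.

Lemma ins1_0 (R : pzSemiRingType) (l : seq R) : ins1 0 l = 1 :: l.
Proof. by rewrite /ins1 take0 drop0. Qed.

Lemma ins1S (R : pzSemiRingType) i (x : R) l : ins1 i.+1 (x :: l) = x :: ins1 i l.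
Proof. by []. Qed.

Lemma size_face (R : pzSemiRingType) i (l : seq R) :
  (i.+1 < size l)%N -> size (face i l) = (size l).-1.
Proof. by move=> il; rewrite size_cat /= size_drop size_takel; lia. Qed.

Lemma size_ins1 (R : pzSemiRingType) i (l : seq R) :
  size (ins1 i l) = (size l).+1.
Proof. by rewrite size_cat /= addnS -size_cat cat_take_drop. Qed.

Lemma act_face M h g i (F : seq H -> M) : slin F -> (i.+1 < size g)%N ->
  act h (face i g) F = act h g (fun l => F (face i l)).
Proof.
elim: i g h F => [|i ih] [|x g] h F Fl // ig; last first.
  by rewrite faceS /=; apply: eq_bsum => a b; rewrite ih //; lin.
case: g ig => // y g _; rewrite face0 /=.
transitivity (DS h (fun a b => DS a (fun a0 a1 => act b g (fun l =>
    F (cj a0 x * cj a1 y :: l))))).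
  apply: eq_bsum => a b; rewrite cj_prod -act_bsum.
  by apply: eq_act => l _; rewrite (@bsum_lin _ _ _ _ _ _ _ (fun u => F (u :: l))) //; lin.
rewrite DS_assoc; [|by lin..].
apply: eq_bsum => a b; apply: eq_bsum => b0 b1; apply: eq_act => l _.
by rewrite face0.
Qed.

Lemma act_ins1 M h g i (F : seq H -> M) : slin F ->
  act h (ins1 i g) F = act h g (fun l => F (ins1 i l)).
Proof.
have ins0 g' h' (F' : seq H -> M) : slin F' ->
    act h' (1 :: g') F' = act h' g' (fun l => F' (1 :: l)).
  move=> Fl; rewrite /= -(DS_counitl (f := fun u => act u g' (fun l => F' (1 :: l)))); last by lin.
  apply: eq_bsum => a b.
  rewrite -(@linZ _ _ _ (fun y => act b g' (fun l => F' (y :: l)))) -?cj1r //; lin.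
elim: i g h F => [|i ih] g h F Fl.
  by rewrite ins1_0 ins0 //; apply: eq_act => l _; rewrite ins1_0.
case: g => [|x g]; first by rewrite [ins1 _ _]/= ins0.
by rewrite ins1S /=; apply: eq_bsum => a b; rewrite ih //; lin.
Qed.

Lemma rA_rcons M a x (F : H -> seq A -> M) :
  rA (rcons a x) F = rA a (fun h a' => RS x (fun h0 x0 => F (h * h0) (rcons a' x0))).
Proof.
elim: a F => [|y a ih] F.
  rewrite rA_nil rA_cons; apply: eq_bsum => h0 x0.
  by rewrite rA_nil mulr1 mul1r.
rewrite rcons_cons !rA_cons; apply: eq_bsum => h0 x0; rewrite ih; apply: eq_bsum => h a'.
by apply: eq_bsum => h1 x1; rewrite mulrA.
Qed.

(** The tensor power of [A] is a comodule under the codiagonal coaction: coassociativity holds entry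
    by entry, and multiplicativity of [Delta] assembles the two legs of each product. *)
Lemma rA_assoc M a (F : H -> H -> seq A -> M) :
  (forall b c, lin (fun a => F a b c)) -> (forall a c, lin (fun b => F a b c)) ->
  (forall a b, slin (F a b)) ->
  rA a (fun h a' => rA a' (fun h' a'' => F h h' a'')) =
  rA a (fun h a' => DS h (fun h0 h1 => F h0 h1 a')).
Proof.
elim: a F => [|x a ih] F F1 F2 F3.
  by rewrite !rA_nil DS_1; [|lin..].
rewrite !rA_cons.
transitivity (RS x (fun h0 x0 => RS x0 (fun k0 x1 => rA a (fun h1 a' => rA a' (fun k1 a'' =>
   F (h0 * h1) (k0 * k1) (x1 :: a'')))))).
  apply: eq_bsum => h0 x0; rewrite [RHS]bsumC; apply: eq_bsum => h1 a'.
  by rewrite rA_cons.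
rewrite RS_assoc; [|by lin..].
apply: eq_bsum => h x0.
transitivity (DS h (fun h0 k0 => rA a (fun h1 a' => DS h1 (fun u v =>
    F (h0 * u) (k0 * v) (x0 :: a'))))).
  by apply: eq_bsum => h0 k0; rewrite (ih (fun u v l => F (h0 * u) (k0 * v) (x0 :: l))) //; lin.
rewrite bsumC; apply: eq_bsum => h1 a'; rewrite DS_mul //; lin.
Qed.

Lemma rA_counit M a (F : seq A -> M) : slin F -> rA a (fun h a' => eps h *: F a') = F a.
Proof.
elim: a F => [|x a ih] F Fl; first by rewrite rA_nil eps1 scale1r.
rewrite rA_cons -(RS_counit (f := fun x => F (x :: a))); last by lin.
apply: eq_bsum => h x0; rewrite -(ih (fun a => F (x0 :: a))); last by lin.
by rewrite bsum_scale; apply: eq_bsum => h' a'; rewrite epsM scalerA.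
Qed.

Lemma rA_face M a i (F : H -> seq A -> M) :
  (forall b, lin (F^~ b)) -> (forall h, slin (F h)) -> (i.+1 < size a)%N ->
  rA (face i a) F = rA a (fun h a' => F h (face i a')).
Proof.
elim: i a F => [|i ih] [|x a] F F1 F2 // ia; last first.
  by rewrite faceS !rA_cons; apply: eq_bsum => h x0; rewrite ih //; lin.
case: a ia => // y a _; rewrite face0 !rA_cons RS_mul; [|by lin..].
apply: eq_bsum => h x0; rewrite rA_cons; apply: eq_bsum => h' y0; apply: eq_bsum => h'' a'.
by rewrite face0 mulrA.
Qed.

Lemma rA_ins1 M a i (F : H -> seq A -> M) :
  (forall b, lin (F^~ b)) -> (forall h, slin (F h)) ->
  rA (ins1 i a) F = rA a (fun h a' => F h (ins1 i a')).
Proof.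
have ins0 a' (F' : H -> seq A -> M) : (forall b, lin (F'^~ b)) -> (forall h, slin (F' h)) ->
    rA (1 :: a') F' = rA a' (fun h a' => F' h (1 :: a')).
  move=> F1 F2; rewrite rA_cons RS_1; [|by lin..].
  by apply: eq_bsum => h0 x0; rewrite mul1r.
elim: i a F => [|i ih] a F F1 F2.
  by rewrite ins1_0 ins0 //; apply: eq_bsum => h l; rewrite ins1_0.
case: a => [|x a]; first by rewrite [ins1 _ _]/= ins0 // !rA_nil.
by rewrite ins1S !rA_cons; apply: eq_bsum => h x0; rewrite ih //; lin.
Qed.

(* The action of [Sinv h], whose comultiplication is reversed. *)
Fixpoint actV M (h : H) (g : seq H) (F : seq H -> M) : M :=
  if g is x :: g' then
    DS h (fun h0 h1 => actV h0 g' (fun l => F (cj (Sinv h1) x :: l)))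
  else eps h *: F [::].

Lemma eq_actV M h g (F G : seq H -> M) :
  (forall l, size l = size g -> F l = G l) -> actV h g F = actV h g G.
Proof.
elim: g h F G => [|x g ih] h F G FG /=; first by rewrite FG.
by apply: eq_bsum => h0 h1; apply: ih => l ls; rewrite FG //= ls.
Qed.

Lemma actV_bsum X Y M (r : seq (X * Y)) h g (F : seq H -> X -> Y -> M) :
  actV h g (fun l => bsum r (F l)) = bsum r (fun a b => actV h g (fun l => F l a b)).
Proof.
elim: g h F => [|y g ih] h F /=; first by rewrite bsum_scale.
rewrite [RHS]bsumC; apply: eq_bsum => a b.
exact: (ih _ (fun l => F (cj (Sinv b) y :: l))).
Qed.

Lemma lin_actVF U M h g (F : U -> seq H -> M) :
  (forall l, lin (fun x => F x l)) -> lin (fun x => actV h g (F x)).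
Proof.
elim: g h F => [|y g ih] h F Fl /=; first by lin.
by apply: lin_bsum => a b; apply: ih.
Qed.

Lemma lin_actVl U M (t : U -> H) g (F : seq H -> M) :
  lin t -> slin F -> lin (fun x => actV (t x) g F).
Proof.
elim: g U t F => [|y g ih] U t F tl Fl /=; first by lin.
apply: lin_DS => // [b|a]; first by apply: ih; lin.
by apply: lin_actVF; lin.
Qed.

Lemma lin_actVr U M h (L : U -> seq H) (F : seq H -> M) :
  slot L -> slin F -> lin (fun x => actV h (L x) F).
Proof.
move=> Ll Fl; apply: (slin_slot (F := fun g => actV h g F)) => //; split.
move=> s1 s2; elim: s1 h F Fl => [|y s1 ih] h F Fl /=.
  by apply: lin_bsum => a b; apply: lin_actVF; lin.
by apply: lin_bsum => a b; apply: ih; lin.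
Qed.

Ltac lin_more ::= first [apply: lin_actl | apply: lin_actr | apply: lin_actF | apply: lin_rA
  | apply: lin_actVl | apply: lin_actVr | apply: lin_actVF].

(** The diagonal form of S^{-1}(h^(1)) h^(0) = eps(h), and the final cancellation behind the
    cylindrical identity. *)
Lemma actV_act M h g (F : seq H -> M) : slin F ->
  DS h (fun h0 h1 => act h0 g (fun l => actV h1 l F)) = eps h *: F g.
Proof.
elim: g h F => [|x g ih] h F Fl /=.
  by rewrite (DS_counitl (f := fun u => eps u *: F [::])); last by lin.
(* The legs occur in the order a, c, b, d, with a and d on the first entry and c and b on the tail.
   The inner pair cancels by induction, after which S^{-1}(d) a cancels on [x]. *)
pose K a c b d := act c g (fun l => actV b l (fun l' => F (cj (Sinv d) (cj a x) :: l'))).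
transitivity (DS h (fun h0 h1 => DS h0 (fun a c => DS h1 (K a c)))).
  by apply: eq_bsum => h0 h1; apply: eq_bsum => a c; rewrite /K -act_bsum.
rewrite DS_assoc; [|by rewrite /K; lin..].
transitivity (DS h (fun a b => F (cj (Sinv b) (cj a x) :: g))).
  apply: eq_bsum => a h'.
  rewrite -(DS_assoc (f := K a)); [|by rewrite /K; lin..].
  rewrite -(DS_counitl (f := fun d => F (cj (Sinv d) (cj a x) :: g))); last by lin.
  by apply: eq_bsum => e d; apply: (ih e (fun l => F (_ :: l))); lin.
rewrite -[in RHS](cj1l x) -(DS_Sinvl (f := fun u => F (cj u x :: g))); last by lin.
by apply: eq_bsum => a b; rewrite cjM.
Qed.

(** * Agreement of the list-valued action [actt] with the recursion [act] *)

Lemma size_Dn n h : all (fun t => size t == n.+1) (Dn Delta n h).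
Proof.
elim: n => //= n /allP ih; apply/allP => t /flatten_mapP[u /ih /eqP su /mapP[y _ ->]] /=.
by rewrite size_behead su.
Qed.

Lemma lin_head_split M (G : seq H -> M) : slin G ->
  slin (fun t => DS (head 0 t) (fun a b => G (a :: b :: behead t))).
Proof. by move=> Gl; apply: slin_recI => [s|y] /=; lin. Qed.

Lemma slin_Dn_sum M n (t : H -> H) (G : seq H -> M) : lin t -> slin G ->
  lin (fun x => \sum_(u <- Dn Delta n (t x)) G u).
Proof.
move=> tl; elim: n G => [|n ih] G Gl.
  by split=> c x y; rewrite !big_seq1; move: c x y; apply: linP; lin.
apply: (eq_lin _ (ih _ (lin_head_split Gl))) => x /=.
by rewrite big_flatten big_map; apply: eq_bigr => u _; rewrite big_map.
Qed.

(** [Dn] always splits the first leg again, whereas [act] splits the second; coassociativity changes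
    one pattern into the other. *)
Lemma Dn_cons M n h (G : seq H -> M) : slin G ->
  \sum_(u <- Dn Delta n.+1 h) G u =
  DS h (fun h0 h1 => \sum_(u <- Dn Delta n h1) G (h0 :: u)).
Proof.
have E m x (G' : seq H -> M) : \sum_(u <- Dn Delta m.+1 x) G' u =
    \sum_(u <- Dn Delta m x) DS (head 0 u) (fun a b => G' (a :: b :: behead u)).
  by rewrite big_flatten big_map; apply: eq_bigr => u _; rewrite big_map.
elim: n h G => [|n ih] h G Gl.
  by rewrite E big_seq1; apply: eq_bsum => a b; rewrite big_seq1.
rewrite E ih /=; last exact: lin_head_split.
transitivity (DS h (fun a b => DS a (fun a0 a1 => \sum_(u <- Dn Delta n b) G (a0 :: a1 :: u)))).
  by apply: eq_bsum => a b; rewrite /bsum exchange_big.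
rewrite DS_assoc.
- by apply: eq_bsum => a b; rewrite -(ih b (fun u => G (a :: u))) //; lin.
- by move=> b c; apply: lin_sum; lin.
- by move=> a c; apply: lin_sum; lin.
- by move=> a b; apply: slin_Dn_sum (lin_id H) _; lin.
Qed.

(* [conj] along two lists, with the second padded so as to stay linear in the first. *)
Fixpoint cjs (hs g : seq H) : seq H :=
  match hs, g with
  | [::], _ => [::]
  | h :: hs', [::] => h :: cjs hs' [::]
  | h :: hs', x :: g' => cj h x :: cjs hs' g'
  end.

Lemma cjs_zip hs g : size hs = size g -> [seq cj y.1 y.2 | y <- zip hs g] = cjs hs g.
Proof. by elim: hs g => [|h hs ih] [|x g] //= [/ih ->]. Qed.

Lemma slin_cjs M g (F : seq H -> M) : slin F -> slin (fun hs => F (cjs hs g)).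
Proof.
move=> Fl; split=> s1 s2; elim: s1 g F Fl => [|y s1 ih] [|x g] F Fl /=; first by lin.
- by lin.
- by apply: (ih [::] (fun l => F (y :: l))); lin.
- by apply: (ih g (fun l => F (cj y x :: l))); lin.
Qed.

Lemma actE M h x g (F : seq H -> M) : slin F ->
  \sum_(g' <- actt Delta S h (x :: g)) F g' = act h (x :: g) F.
Proof.
move=> Fl; rewrite big_map [(size _).-1]/=.
transitivity (\sum_(hs <- Dn Delta (size g) h) F (cjs hs (x :: g))).
  apply: eq_big_seq => hs hsD; rewrite cjs_zip //.
  by have /allP/(_ _ hsD)/eqP := size_Dn (size g) h.
elim: g h x F Fl => [|y g ih] h x F Fl.
  by rewrite big_seq1 /= -(DS_counitr (f := fun h => F [:: cj h x])) //; lin.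
rewrite [size _]/= Dn_cons; last exact: slin_cjs.
by apply: eq_bsum => a b; rewrite (ih b y (fun l => F (cj a x :: l))) //; lin.
Qed.

Lemma size_actt h x g g' : g' \in actt Delta S h (x :: g) -> size g' = (size g).+1.
Proof.
case/mapP=> hs hsD ->; rewrite size_map size_zip /=.
by have /allP/(_ _ hsD)/eqP -> := size_Dn (size g) h; rewrite minnn.
Qed.

Lemma size_rho_all a z : z \in rho_all rho a -> size z.2 = size a.
Proof.
elim: a z => [|x a ih] z /=; first by rewrite inE => /eqP->.
by case/allpairsPdep=> u [v [_ /ih sv ->]] /=; rewrite sv.
Qed.

(** * Operators and their pullbacks *)

Definition mlin M (phi : seq H -> seq A -> M) : Prop :=
  (forall a, slin (phi^~ a)) /\ (forall g, slin (phi g)).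

Local Notation cvl p q := (@cvalid k H A p q).

Lemma cvalid_cons p q g a l :
  cvl p q ((g, a) :: l) -> [/\ size g = p.+1, size a = q.+1 & cvl p q l].
Proof. by case/andP => /= /andP[/eqP ? /eqP ?]. Qed.

Lemma eq_bsumv M p q l (phi psi : seq H -> seq A -> M) : cvl p q l ->
  (forall g a, size g = p.+1 -> size a = q.+1 -> phi g a = psi g a) ->
  bsum l phi = bsum l psi.
Proof.
move=> + e; rewrite /bsum; elim: l => [|[g a] l ih]; first by rewrite !big_nil.
by case/cvalid_cons=> sg sa /ih; rewrite !big_cons /= e // => ->.
Qed.

Lemma mlin_multilin M n m (phi : seq H -> seq A -> M) : mlin phi ->
  multilin n m (fun x : pt H A => phi x.1 x.2).
Proof.
move=> [p1 p2]; split=> g a i c x y sg sa ii /=; rewrite !set_nthE ?sg ?sa ii.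
  by case: (p1 a) => pl; apply: (linP (pl _ _)).
by case: (p2 g) => pl; apply: (linP (pl _ _)).
Qed.

(* A multilinear map only constrained in one bidegree may be replaced by its
   extension by zero, which is multilinear on lists of every size. *)
Lemma multilin_mlin M n m (phi : pt H A -> M) : multilin n m phi ->
  mlin (fun g a => if (size g == n) && (size a == m) then phi (g, a) else 0).
Proof.
have setE (T : nmodType) (s1 s2 : seq T) x :
    s1 ++ x :: s2 = set_nth 0 (s1 ++ 0 :: s2) (size s1) x.
  by elim: s1 => //= z s1 <-.
move=> [p1 p2]; split=> u; split=> s1 s2; split=> c x y;
  rewrite !size_cat /=; case: ifP => [/andP[/eqP s /eqP s']|_]; rewrite ?scaler0 ?addr0 //.
  by rewrite (setE _ s1 s2 x) (setE _ s1 s2 y) (setE _ s1 s2 (_ + _)) p1 ?size_cat //=; lia.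
by rewrite (setE _ s1 s2 x) (setE _ s1 s2 y) (setE _ s1 s2 (_ + _)) p2 ?size_cat //=; lia.
Qed.

(** Equality in the tensor product may be tested on [mlin] functions alone: these restrict to
    multilinear maps in the given bidegree, and every such map extends by zero. Pullbacks of [mlin]
    functions are again [mlin], so tests can be composed. *)
Lemma ceqvP p q l1 l2 : cvl p q l1 -> cvl p q l2 ->
  ceqv p q l1 l2 <->
  forall M (phi : seq H -> seq A -> M), mlin phi -> bsum l1 phi = bsum l2 phi.
Proof.
move=> v1 v2; split=> [e M phi /mlin_multilin pm|e M phi /multilin_mlin pm]; first exact: e.
have E l : cvl p q l -> \sum_(x <- l) phi x =
    bsum l (fun g a => if (size g == p.+1) && (size a == q.+1) then phi (g, a) else 0).
  move=> vl; transitivity (bsum l (fun g a => phi (g, a))).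
    by apply: eq_bigr => -[].
  by apply: eq_bsumv vl _ => g a -> ->; rewrite !eqxx.
by rewrite !E // e.
Qed.

Lemma bsum_scl M p q c l (phi : seq H -> seq A -> M) : mlin phi -> cvl p q l ->
  bsum (sclfs c l) phi = c *: bsum l phi.
Proof.
move=> [p1 _] vl; rewrite bsum_scale /bsum big_map.
transitivity (bsum l (fun g a => phi (sclpt c (g, a)).1 (sclpt c (g, a)).2)).
  by apply: eq_bigr => -[].
rewrite -[RHS]/(bsum l (fun g a => c *: phi g a)); apply: eq_bsumv vl _ => -[//|x g] a _ _ /=.
by rewrite (linZ _ _ (f := fun x => phi (x :: g) a)) //; lin.
Qed.

Lemma cvalid_scl p q c l : cvl p q l -> cvl p q (sclfs c l).
Proof.
rewrite /cvalid /sclfs all_map; apply: sub_all => -[[|x g] [|y a]] //=.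
Qed.

Lemma cvalid_cat p q l1 l2 : cvl p q l1 -> cvl p q l2 -> cvl p q (l1 ++ l2).
Proof. by rewrite /cvalid all_cat => -> ->. Qed.

(* The operator [F] on formal sums is dual to the operator [T] on multilinear maps. *)
Definition rep p q p' q' (F : seq (pt H A) -> seq (pt H A))
    (T : forall M : lmodType k, (seq H -> seq A -> M) -> seq H -> seq A -> M) : Prop :=
  (forall l, cvl p q l -> cvl p' q' (F l)) /\
  (forall M phi, mlin phi -> mlin (T M phi) /\
     forall l, cvl p q l -> bsum (F l) phi = bsum l (T M phi)).

Lemma rep_ext p q p' q' f
    (T : forall M : lmodType k, (seq H -> seq A -> M) -> seq H -> seq A -> M) :
  (forall g a, size g = p.+1 -> size a = q.+1 -> cvl p' q' (f (g, a))) ->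
  (forall M phi, mlin phi -> mlin (T M phi)) ->
  (forall M phi g a, mlin phi -> size g = p.+1 -> size a = q.+1 ->
     bsum (f (g, a)) phi = T M phi g a) ->
  rep p q p' q' (ext f) T.
Proof.
move=> fv Tm fT; split=> [l|M phi pm].
  elim: l => [//|[g a] l ih] /cvalid_cons[sg sa /ih vl].
  by apply: cvalid_cat vl; apply: fv.
split=> [|l vl]; first exact: Tm.
transitivity (bsum l (fun g a => bsum (f (g, a)) phi)).
  by rewrite /bsum /ext big_flatten big_map; apply: eq_bigr => -[].
by apply: eq_bsumv vl _ => g a sg sa; apply: fT.
Qed.

Lemma rep_id p q : rep p q p q id (fun M phi => phi).
Proof. by []. Qed.

(** Passing to pullbacks is contravariant: the pullback of [F \o G] applies that of [F] first. The
    relations below are therefore written with the operators in the opposite order. *)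
Lemma rep_comp p q p' q' p'' q'' F G T T' :
  rep p' q' p'' q'' F T -> rep p q p' q' G T' ->
  rep p q p'' q'' (F \o G) (fun M phi => T' M (T M phi)).
Proof.
move=> [Fv FT] [Gv GU]; split=> [l vl|M phi pm]; first by apply/Fv/Gv.
have [Tm FTe] := FT M phi pm; have [Um GUe] := GU M _ Tm.
by split=> // l vl /=; rewrite FTe ?GUe //; apply: Gv.
Qed.

Lemma rep_iter p q n F T : rep p q p q F T ->
  rep p q p q (iter n F) (fun M => iter n (T M)).
Proof.
move=> r; elim: n => [|n ih]; first exact: rep_id.
have [v e] := rep_comp r ih; split=> // M phi pm.
by rewrite iterSr; apply: e.
Qed.

Lemma linmap_rep p q p' q' F T : rep p q p' q' F T ->
  linmap (@sclfs k H A) (cvl p q) (@ceqv k H A p q) (cvl p' q') (@ceqv k H A p' q') F.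
Proof.
move=> [Fv FT]; split=> [//|l1 l2 v1 v2|l1 l2 v1 v2|c l vl].
- rewrite !ceqvP; [|by auto..] => e M phi pm.
  by have [Tm Fe] := FT M phi pm; rewrite !Fe // e.
- have v12 := cvalid_cat v1 v2; rewrite ceqvP; [|by auto using cvalid_cat..].
  by move=> M phi pm; have [Tm Fe] := FT M phi pm; rewrite /bsum big_cat -!/(bsum _ _) !Fe // /bsum big_cat.
- have vc := cvalid_scl c vl; rewrite ceqvP; [|by auto using cvalid_scl..].
  move=> M phi pm; have [Tm Fe] := FT M phi pm.
  by rewrite Fe // (bsum_scl _ Tm vl) (bsum_scl _ pm (Fv _ vl)) Fe.
Qed.

Lemma eqmap_rep p q p' q' F G T T' : rep p q p' q' F T -> rep p q p' q' G T' ->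
  (forall M phi g a, mlin phi -> size g = p.+1 -> size a = q.+1 -> T M phi g a = T' M phi g a) ->
  eqmap (cvl p q) (@ceqv k H A p' q') F G.
Proof.
move=> [Fv FT] [Gv GU] TU l vl; rewrite ceqvP; [|by auto..] => M phi pm.
have [_ Fe] := FT M phi pm; have [_ Ge] := GU M phi pm.
by rewrite Fe // Ge //; apply: eq_bsumv vl _ => g a; apply: TU.
Qed.

(** * Simplicial identities for multiplying neighbours and inserting units in a list *)

Section ListIdentities.
Variable R : pzSemiRingType.
Implicit Types (x y : R) (l : seq R).

Lemma ltn_size_face l i n : (n.+1 < size l)%N -> (i.+1 < size l)%N ->
  (n < size (face i l))%N.
Proof. by move=> nl il; rewrite size_face //; lia. Qed.

Lemma face_face l i j : (i < j)%N -> (j.+1 < size l)%N ->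
  face i (face j l) = face j.-1 (face i l).
Proof.
elim: i j l => [|i ih] [|j] // [|x l] //= ij jl; last first.
  by case: j ij jl => // j ij jl; rewrite !faceS ih //; lia.
case: l jl => [|y l] //= jl; case: j {ij} jl => [|j] jl.
  by case: l jl => // z l _; rewrite faceS !face0 mulrA.
by rewrite [in RHS]face0 !faceS face0.
Qed.

Lemma ins1_ins1 l i j : (i <= j)%N -> (j <= size l)%N ->
  ins1 i (ins1 j l) = ins1 j.+1 (ins1 i l).
Proof.
elim: i j l => [|i ih] j l ij jl; first by rewrite !ins1_0.
case: j l ij jl => [|j] [|x l] //= ij jl; rewrite !ins1S ih //; lia.
Qed.

Lemma face_ins1_lt l i j : (i.+1 < j)%N -> (j <= size l)%N ->
  face i (ins1 j l) = ins1 j.-1 (face i l).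
Proof.
elim: i j l => [|i ih] [|j] // [|x l] //= ij jl; last first.
  by case: j ij jl => // j ij jl; rewrite !(ins1S, faceS) ih //; lia.
by case: j l ij jl => [|j] [|y l] //= ij jl; rewrite [in RHS]face0 !ins1S face0.
Qed.

Lemma face_ins1 l j : (j < size l)%N -> face j (ins1 j l) = l.
Proof.
elim: j l => [|j ih] [|x l] //= jl; first by rewrite ins1_0 face0 mul1r.
by rewrite ins1S faceS ih.
Qed.

Lemma face_ins1S l j : (j < size l)%N -> face j (ins1 j.+1 l) = l.
Proof.
elim: j l => [|j ih] [|x l] //= jl; first by rewrite ins1S ins1_0 face0 mulr1.
by rewrite ins1S faceS ih.
Qed.

Lemma face_ins1_gt l i j : (j < i)%N -> (i < size l)%N ->
  face i (ins1 j l) = ins1 j (face i.-1 l).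
Proof.
elim: j i l => [|j ih] [|i] // [|x l] //= ij jl; first by rewrite !ins1_0 faceS.
by case: i ij jl => // i ij jl; rewrite !(ins1S, faceS) ih //; lia.
Qed.

Lemma face_rcons l x i : (i.+1 < size l)%N -> face i (rcons l x) = rcons (face i l) x.
Proof.
elim: i l => [|i ih] [|y l] // il; last by rewrite rcons_cons !faceS ih.
by case: l il => // z l _; rewrite [in RHS]face0 !rcons_cons face0.
Qed.

Lemma face_rcons_last l x y : face (size l) (rcons (rcons l x) y) = rcons l (x * y).
Proof. by elim: l => [|z l ih]; rewrite ?rcons_cons ?faceS ?ih ?face0. Qed.

Lemma ins1_rcons l x i : (i <= size l)%N -> ins1 i (rcons l x) = rcons (ins1 i l) x.
Proof.
elim: i l => [|i ih] l il; first by rewrite !ins1_0.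
by case: l il => // y l il; rewrite rcons_cons !ins1S ih.
Qed.

Lemma ins1_last l i : i = size l -> ins1 i l = rcons l 1.
Proof. by move=> ->; rewrite /ins1 take_size drop_size cats1. Qed.

Lemma take_belast l x : take (size (rcons l x)).-1 (rcons l x) = l.
Proof. by rewrite size_rcons -cats1 take_size_cat. Qed.

End ListIdentities.

(** Separates the last entry because the cyclic operators remove it and move it to the front. *)
Lemma slin_lastI (V M : lmodType k) (F : seq V -> M) :
  (forall s, lin (fun x => F (rcons s x))) -> (forall y, slin (fun s => F (rcons s y))) ->
  slin F.
Proof.
move=> Fl Fi; split=> s1; case/lastP=> [|s2 y].
  by apply: (eq_lin _ (Fl s1)) => x; rewrite cats1.
case: (Fi y) => /(_ s1 s2); apply: eq_lin => x.
by rewrite -rcons_cons -rcons_cat.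
Qed.

Lemma slin_face (B : algType k) M i (F : seq B -> M) : slin F ->
  slin (fun l => if (i.+1 < size l)%N then F (face i l) else 0).
Proof.
have lin0 : lin (fun _ : B => 0 : M) by split=> c x y; rewrite scaler0 addr0.
move=> Fl; split=> s1; elim: i s1 F Fl => [|i ih] s1 F Fl s2.
  case: s1 => [|y [|z s1]].
  - case: s2 => [|y s2] //=.
    by apply: (eq_lin (fun x => congr1 F (face0 x y s2))); lin.
  - by apply: (eq_lin (fun x => congr1 F (face0 y x s2))); lin.
  - by apply: (eq_lin (fun x => congr1 F (face0 y z (s1 ++ x :: s2)))); lin.
case: s1 => [|y s1].
  case E: (i.+1 < size s2)%N.
    by apply: (eq_lin (g := fun x => F (x :: face i s2))) => [x|]; [rewrite cat0s /= ltnS E faceS | lin].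
  by apply: (eq_lin (g := fun=> 0)) => [x|//]; rewrite /= ltnS E.
by apply: (ih s1 (fun l => F (y :: l))); lin.
Qed.

Lemma slin_ins1 (B : algType k) M i (F : seq B -> M) : slin F ->
  slin (fun l => F (ins1 i l)).
Proof.
move=> Fl; split=> s1; elim: i s1 F Fl => [|i ih] s1 F Fl s2.
  by apply: (eq_lin (fun x => congr1 F (ins1_0 _))); lin.
case: s1 => [|y s1]; first by apply: (eq_lin (fun x => congr1 F (ins1S i x s2))); lin.
by apply: (ih s1 (fun l => F (y :: l))); lin.
Qed.

Section Operators.
Variable M : lmodType k.
Implicit Types (phi : seq H -> seq A -> M) (g : seq H) (a : seq A).

(** The value zero out of range keeps the pullback linear in each entry at every length, as [mlin]
    asks. *)
Definition VF i phi g a : M := if (i.+1 < size a)%N then phi g (face i a) else 0.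
(** The shift to [i.+1] appears because [ins1] counts the position of the new unit, while the
    degeneracy counts the entry that precedes it. *)
Definition VS i phi g a : M := phi g (ins1 i.+1 a).
Definition VT phi g a : M :=
  RS (last 0 a) (fun h x => act h g (fun g' => phi g' (x :: take (size a).-1 a))).
Definition HF i phi g a : M := if (i.+1 < size g)%N then phi (face i g) a else 0.
Definition HS i phi g a : M := phi (ins1 i.+1 g) a.
Definition HT phi g a : M :=
  rA a (fun h a' => phi (cj (Sinv h) (last 0 g) :: take (size g).-1 g) a').

Lemma VFE i phi g a : (i.+1 < size a)%N -> VF i phi g a = phi g (face i a).
Proof. by rewrite /VF => ->. Qed.

Lemma HFE i phi g a : (i.+1 < size g)%N -> HF i phi g a = phi (face i g) a.
Proof. by rewrite /HF => ->. Qed.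

Lemma VT_rcons phi g a x :
  VT phi g (rcons a x) = RS x (fun h x0 => act h g (fun g' => phi g' (x0 :: a))).
Proof. by rewrite /VT last_rcons take_belast. Qed.

Lemma HT_rcons phi g x a :
  HT phi (rcons g x) a = rA a (fun h a' => phi (cj (Sinv h) x :: g) a').
Proof. by rewrite /HT last_rcons take_belast. Qed.

Lemma mlin_VF i phi : mlin phi -> mlin (VF i phi).
Proof.
move=> [p1 p2]; split=> [a|g]; last exact: slin_face.
by rewrite /VF; case: (i.+1 < size a)%N => //; split=> *; split=> *; rewrite scaler0 addr0.
Qed.

Lemma mlin_HF i phi : mlin phi -> mlin (HF i phi).
Proof.
move=> [p1 p2]; split=> [a|g]; first exact: (slin_face i (p1 a)).
by rewrite /HF; case: (i.+1 < size g)%N => //; split=> *; split=> *; rewrite scaler0 addr0.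
Qed.

Lemma mlin_VS i phi : mlin phi -> mlin (VS i phi).
Proof. by move=> [p1 p2]; split=> [a|g]; [exact: p1 | exact: slin_ins1]. Qed.

Lemma mlin_HS i phi : mlin phi -> mlin (HS i phi).
Proof. by move=> [p1 p2]; split=> [a|g]; [exact: (slin_ins1 _ (p1 a)) | exact: p2]. Qed.

Lemma mlin_VT phi : mlin phi -> mlin (VT phi).
Proof.
move=> [p1 p2]; split=> [a|g]; first by rewrite /VT; lin.
apply: slin_lastI => [a|x]; first by apply: (eq_lin (fun x => VT_rcons phi g a x)); lin.
apply: slinI => L Ll; apply: (eq_lin (fun y => VT_rcons phi g (L y) x)); lin.
Qed.

Lemma mlin_HT phi : mlin phi -> mlin (HT phi).
Proof.
move=> [p1 p2]; split=> [a|g]; last by rewrite /HT; lin.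
apply: slin_lastI => [g|x]; first by apply: (eq_lin (fun x => HT_rcons phi g x a)); lin.
apply: slinI => L Ll; apply: (eq_lin (fun y => HT_rcons phi (L y) x a)); lin.
Qed.

End Operators.

Local Notation vd := (@cvd k H A Delta S rho).
Local Notation vs := (@cvs k H A).
Local Notation vt := (@cvt k H A Delta S rho).
Local Notation hd := (@chd k H A Delta S Sinv rho).
Local Notation hs := (@chs k H A).
Local Notation ht := (@cht k H A Delta S Sinv rho).

(** * Each operator is dual to its pullback; last faces factor through the cyclic operators *)

Lemma cvalid1 p q g a : size g = p.+1 -> size a = q.+1 -> cvl p q [:: (g, a)].
Proof. by rewrite /cvalid /= => -> ->; rewrite !eqxx. Qed.

Lemma bsum1 X Y M x y (f : X -> Y -> M) : bsum [:: (x, y)] f = f x y.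
Proof. exact: big_seq1. Qed.

Lemma rep_VF p q i : (i <= q)%N -> rep p q.+1 p q (vd p q i) (fun M => @VF M i).
Proof.
move=> iq; apply: rep_ext => [g a sg sa|M phi|M phi g a _ sg sa].
- by rewrite /vd_pt sa ltnS iq; apply: cvalid1; rewrite // size_face sa.
- exact: mlin_VF.
- by rewrite VFE /vd_pt sa ?ltnS ?iq // bsum1.
Qed.

Lemma rep_HF p q i : (i <= p)%N -> rep p.+1 q p q (hd p q i) (fun M => @HF M i).
Proof.
move=> iq; apply: rep_ext => [g a sg sa|M phi|M phi g a _ sg sa].
- by rewrite /hd_pt sg ltnS iq; apply: cvalid1; rewrite // size_face sg.
- exact: mlin_HF.
- by rewrite HFE /hd_pt sg ?ltnS ?iq // bsum1.
Qed.

Lemma rep_VS p q i : rep p q p q.+1 (vs p q i) (fun M => @VS M i).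
Proof.
apply: rep_ext => [g a sg sa|M phi|M phi g a _ sg sa].
- by apply: cvalid1; rewrite // (@size_ins1 A) sa.
- exact: mlin_VS.
- exact: bsum1.
Qed.

Lemma rep_HS p q i : rep p q p.+1 q (hs p q i) (fun M => @HS M i).
Proof.
apply: rep_ext => [g a sg sa|M phi|M phi g a _ sg sa].
- by apply: cvalid1; rewrite // (@size_ins1 H) sg.
- exact: mlin_HS.
- exact: bsum1.
Qed.

Lemma rep_VT p q : rep p q p q (vt p q) (@VT).
Proof.
apply: rep_ext => [[//|x g] a sg sa|M phi|M phi [//|x g] a [p1 p2] sg sa].
- apply/allP => _ /flatten_mapP[y _ /mapP[g' /size_actt sg' ->]] /=.
  by rewrite sg' -sg /= size_takel sa // !eqxx.
- exact: mlin_VT.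
- rewrite /bsum big_flatten big_map; apply: eq_bigr => y _.
  by rewrite big_map -actE //; lin.
Qed.

Lemma rep_HT p q : rep p q p q (ht p q) (@HT).
Proof.
apply: rep_ext => [g a sg sa|M phi|M phi g a _ sg sa].
- apply/allP => _ /mapP[z /size_rho_all sz ->] /=.
  by rewrite size_takel sg // sz sa !eqxx.
- exact: mlin_HT.
- by rewrite /bsum big_map.
Qed.

Lemma ext_cat (f : pt H A -> seq (pt H A)) l1 l2 : ext f (l1 ++ l2) = ext f l1 ++ ext f l2.
Proof. by rewrite /ext map_cat flatten_cat. Qed.

Lemma ext_flatten (f : pt H A -> seq (pt H A)) ss : ext f (flatten ss) = flatten (map (ext f) ss).
Proof. by elim: ss => //= s ss <-; rewrite ext_cat. Qed.

Lemma ext_map T (f : pt H A -> seq (pt H A)) (u v : T -> pt H A) s :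
  (forall x, f (u x) = [:: v x]) -> ext f (map u s) = map v s.
Proof. by move=> fuv; elim: s => //= x s <-; rewrite /ext /= fuv. Qed.

(** An equality of lists: both sides run through the same representatives of the coaction and of the
    iterated coproduct, in the same order. *)
Lemma vd_last p q l : cvl p q.+1 l -> vd p q q.+1 l = vd p q 0 (vt p q.+1 l).
Proof.
elim: l => [//|[g a] l ih] /cvalid_cons[_ sa /ih {}ih].
rewrite /cvt [in RHS]/ext /= [RHS]ext_cat -[in RHS]/(ext _ l); congr (_ ++ _); last exact: ih.
rewrite [LHS]/vd_pt sa [_.-1]/= ltnn ext_flatten -map_comp; congr flatten; apply: eq_map => y /=.
rewrite (@ext_map _ _ _ (fun g' => (g', y.2 * head 0 a :: behead (take q.+1 a)))) // => g'.
by case: a sa => [|x [|x' a]] //= _; rewrite drop0.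
Qed.

Lemma hd_last p q l : cvl p.+1 q l -> hd p q p.+1 l = hd p q 0 (ht p.+1 q l).
Proof.
elim: l => [//|[g a] l ih] /cvalid_cons[sg _ /ih {}ih].
rewrite /cht [in RHS]/ext /= [RHS]ext_cat -[in RHS]/(ext _ l); congr (_ ++ _); last exact: ih.
rewrite [LHS]/hd_pt sg [_.-1]/= ltnn.
rewrite (@ext_map _ _ _ (fun z => (cj (Sinv z.1) (last 0 g) * head 0 g :: behead (take p.+1 g), z.2)))
  // => z.
by case: g sg => [|x [|x' g]] //= _; rewrite drop0.
Qed.

(** * The relations between operators, stated on pullbacks *)

Section Relations.
Variable M : lmodType k.
Variable phi : seq H -> seq A -> M.
Hypothesis phil : mlin phi.
Implicit Types (g : seq H) (a : seq A).

Lemma VF_VF g a i j : (i < j)%N -> (j.+1 < size a)%N ->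
  VF j (VF i phi) g a = VF i (VF j.-1 phi) g a.
Proof.
move=> ij ja; have ia : (i.+1 < size a)%N by lia.
have i1 : (i.+1 < size (face j a))%N by apply: ltn_size_face => //; apply: leq_ltn_trans ja.
have j1 : (j.-1.+1 < size (face i a))%N by apply: ltn_size_face => //; case: j ij ja {i1}.
by rewrite !VFE // face_face.
Qed.

Lemma VS_VS g a i j : (i <= j)%N -> (j < size a)%N ->
  VS j (VS i phi) g a = VS i (VS j.+1 phi) g a.
Proof. by move=> ij ja; rewrite /VS ins1_ins1. Qed.

Lemma VS_VF_lt g a i j : (i < j)%N -> (j < size a)%N ->
  VS j (VF i phi) g a = VF i (VS j.-1 phi) g a.
Proof.
case: j => // j ij ja; have ia : (i.+1 < size a)%N by lia.
rewrite /VS !VFE //; first by rewrite face_ins1_lt.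
by rewrite size_ins1 ltnS; apply: leq_trans ij (ltnW ja).
Qed.

Lemma VS_VF g a j : (j < size a)%N -> VS j (VF j phi) g a = phi g a.
Proof.
by move=> ja; rewrite /VS VFE ?face_ins1S // size_ins1.
Qed.

Lemma VS_VFS g a j : (j.+1 < size a)%N -> VS j (VF j.+1 phi) g a = phi g a.
Proof.
by move=> ja; rewrite /VS VFE ?face_ins1 // size_ins1.
Qed.

Lemma VS_VF_gt g a i j : (j.+1 < i)%N -> (i < size a)%N ->
  VS j (VF i phi) g a = VF i.-1 (VS j phi) g a.
Proof.
case: i => // i ij ia; rewrite /VS !VFE //; first by rewrite face_ins1_gt.
by rewrite size_ins1.
Qed.

Lemma HF_HF g a i j : (i < j)%N -> (j.+1 < size g)%N ->
  HF j (HF i phi) g a = HF i (HF j.-1 phi) g a.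
Proof.
move=> ij jg; have ig : (i.+1 < size g)%N by lia.
have i1 : (i.+1 < size (face j g))%N by apply: ltn_size_face => //; apply: leq_ltn_trans jg.
have j1 : (j.-1.+1 < size (face i g))%N by apply: ltn_size_face => //; case: j ij jg {i1}.
by rewrite !HFE // face_face.
Qed.

Lemma HS_HS g a i j : (i <= j)%N -> (j < size g)%N ->
  HS j (HS i phi) g a = HS i (HS j.+1 phi) g a.
Proof. by move=> ij jg; rewrite /HS ins1_ins1. Qed.

Lemma HS_HF_lt g a i j : (i < j)%N -> (j < size g)%N ->
  HS j (HF i phi) g a = HF i (HS j.-1 phi) g a.
Proof.
case: j => // j ij jg; have ig : (i.+1 < size g)%N by lia.
rewrite /HS !HFE //; first by rewrite face_ins1_lt.
by rewrite size_ins1 ltnS; apply: leq_trans ij (ltnW jg).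
Qed.

Lemma HS_HF g a j : (j < size g)%N -> HS j (HF j phi) g a = phi g a.
Proof.
by move=> jg; rewrite /HS HFE ?face_ins1S // size_ins1.
Qed.

Lemma HS_HFS g a j : (j.+1 < size g)%N -> HS j (HF j.+1 phi) g a = phi g a.
Proof.
by move=> jg; rewrite /HS HFE ?face_ins1 // size_ins1.
Qed.

Lemma HS_HF_gt g a i j : (j.+1 < i)%N -> (i < size g)%N ->
  HS j (HF i phi) g a = HF i.-1 (HS j phi) g a.
Proof.
case: i => // i ij ig; rewrite /HS !HFE //; first by rewrite face_ins1_gt.
by rewrite size_ins1.
Qed.

Lemma VT_VF g a i : (0 < i)%N -> (i.+1 < size a)%N ->
  VT (VF i phi) g a = VF i.-1 (VT phi) g a.
Proof.
case: i => // i _; case/lastP: a => [//|a x]; rewrite size_rcons ltnS => ia.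
rewrite VFE ?size_rcons ?face_rcons ?VT_rcons //; last by rewrite ltnW.
apply: eq_bsum => h x0; apply: eq_act => g' _.
by rewrite VFE ?faceS.
Qed.

Lemma VT_VS g a i : (0 < i)%N -> (i < size a)%N ->
  VT (VS i phi) g a = VS i.-1 (VT phi) g a.
Proof.
case: i => // i _; case/lastP: a => [//|a x]; rewrite size_rcons ltnS => ia.
rewrite /VS ins1_rcons // !VT_rcons.
by apply: eq_bsum => h x0; apply: eq_act => g' _; rewrite ins1S.
Qed.

Lemma VT_1 g a : VT phi g (rcons a 1) = phi g (1 :: a).
Proof. by case: phil => p1 p2; rewrite VT_rcons RS_1; [rewrite act_1 //; lin | lin..]. Qed.

(** Two rotations act by y^(1) and then by x^(1), that is by their product, which is the coaction
    component of xy because the coaction is multiplicative. *)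
Lemma VT_VF_last g a i : size a = i.+2 -> VT (VT (VF 0 phi)) g a = VF i (VT phi) g a.
Proof.
case: phil => p1 p2; case/lastP: a => [//|a y]; case/lastP: a => [//|a x].
rewrite !size_rcons => -[sa]; rewrite VFE ?size_rcons ?sa // -sa face_rcons_last !VT_rcons.
rewrite RS_mul; [|by lin..]; rewrite bsumC; apply: eq_bsum => h y0.
transitivity (act h g (fun g' => RS x (fun h' x0 => act h' g' (fun g'' => phi g'' (x0 * y0 :: a))))).
  apply: eq_act => g' _; rewrite -rcons_cons VT_rcons; apply: eq_bsum => h' x0.
  by apply: eq_act => g'' _; rewrite VFE // face0.
by rewrite act_bsum; apply: eq_bsum => h' x0; rewrite act_M //; lin.
Qed.

Lemma HT_HF g a i : (0 < i)%N -> (i.+1 < size g)%N ->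
  HT (HF i phi) g a = HF i.-1 (HT phi) g a.
Proof.
case: i => // i _; case/lastP: g => [//|g x]; rewrite size_rcons ltnS => ig.
rewrite HFE ?size_rcons ?face_rcons ?HT_rcons //; last by rewrite ltnW.
by apply: eq_bsum => h a'; rewrite HFE ?faceS.
Qed.

Lemma HT_HS g a i : (0 < i)%N -> (i < size g)%N ->
  HT (HS i phi) g a = HS i.-1 (HT phi) g a.
Proof.
case: i => // i _; case/lastP: g => [//|g x]; rewrite size_rcons ltnS => ig.
rewrite /HS ins1_rcons // !HT_rcons.
by apply: eq_bsum => h a'; rewrite ins1S.
Qed.

(** Conjugation sends the unit to eps(h) times the unit, and this scalar is absorbed by the counit
    of the codiagonal coaction. *)
Lemma HT_1 g a : HT phi (rcons g 1) a = phi (1 :: g) a.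
Proof.
case: phil => p1 p2; rewrite HT_rcons -(@rA_counit _ a (phi (1 :: g))) //.
apply: eq_bsum => h a'; rewrite cjV1r.
by rewrite (linZ _ _ (f := fun x => phi (x :: g) a')) //; lin.
Qed.

(** The first rotation moves y by S^{-1}(h^(0)), the second moves x by S^{-1}(h^(1)), by
    coassociativity of the coaction. The reversed legs in [cjV_prod] are exactly those needed to
    reassemble S^{-1}(h) acting on xy. *)
Lemma HT_HF_last g a i : size g = i.+2 -> HT (HT (HF 0 phi)) g a = HF i (HT phi) g a.
Proof.
case: phil => p1 p2; case/lastP: g => [//|g y]; case/lastP: g => [//|g x].
rewrite !size_rcons => -[sg]; rewrite HFE ?size_rcons ?sg // -sg face_rcons_last !HT_rcons.
transitivity (rA a (fun h a' => rA a' (fun h' a'' =>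
    phi (cj (Sinv h') x * cj (Sinv h) y :: g) a''))).
  apply: eq_bsum => h a'; rewrite -rcons_cons HT_rcons; apply: eq_bsum => h' a''.
  by rewrite HFE // face0.
rewrite rA_assoc; [|by lin..]; apply: eq_bsum => h a'.
by rewrite cjV_prod (@bsum_lin _ _ _ _ _ _ _ (fun u => phi (u :: g) a')) //; lin.
Qed.

Lemma VT_HF g a i : (i.+1 < size g)%N -> VT (HF i phi) g a = HF i (VT phi) g a.
Proof.
case: phil => p1 p2 ig; rewrite HFE // /VT; apply: eq_bsum => h x.
by rewrite act_face //; apply: eq_act => g' sg'; rewrite HFE ?sg'.
Qed.

Lemma VT_HS g a i : VT (HS i phi) g a = HS i (VT phi) g a.
Proof.
by case: phil => p1 p2; apply: eq_bsum => h x; rewrite act_ins1 //; lin.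
Qed.

Lemma HT_VF g a i : (i.+1 < size a)%N -> HT (VF i phi) g a = VF i (HT phi) g a.
Proof.
case: phil => p1 p2 ia; rewrite VFE // /HT rA_face //; [|by lin..].
by apply: eq_rA => h a' sa'; rewrite VFE ?sa'.
Qed.

Lemma HT_VS g a i : HT (VS i phi) g a = VS i (HT phi) g a.
Proof. by case: phil => p1 p2; rewrite /VS /HT rA_ins1 //; lin. Qed.

Lemma VT_HT g a : (0 < size g)%N -> (0 < size a)%N -> VT (HT phi) g a = HT (VT phi) g a.
Proof.
case: phil => p1 p2; case/lastP: g => [//|g y] _; case/lastP: a => [//|a x] _.
(* [R] is the common value, in which the coaction of [x] no longer touches [y]. With the vertical
   rotation first, the three legs of [x] act on [g], act on [y], and enter through [Sinv], so
   S^{-1}(h^(2)) h^(1) cancels. With the horizontal one first, they enter through [Sinv], act on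
   [y], and act on [g], so h^(1) S^{-1}(h^(0)) cancels. *)
pose R := RS x (fun h x0 => act h g (fun g' => rA a (fun h' a' =>
  phi (cj (Sinv h') y :: g') (x0 :: a')))).
transitivity R.
  rewrite VT_rcons /R.
  transitivity (RS x (fun h x0 => RS x0 (fun h2 x1 => DS h (fun h0 h1 => act h0 g (fun g' =>
     rA a (fun h' a' => phi (cj (Sinv (h2 * h')) (cj h1 y) :: g') (x1 :: a'))))))).
    apply: eq_bsum => h x0; rewrite act_rcons; last by have [m _] := mlin_HT phil; exact: m.
    rewrite [RHS]bsumC; apply: eq_bsum => h0 h1; rewrite -act_bsum; apply: eq_act => g' _.
    by rewrite HT_rcons rA_cons.
  rewrite RS_assoc; [|by lin..].
  apply: eq_bsum => h x0.
  rewrite DS_assoc; [|by lin..].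
  rewrite -(DS_counitr (f := fun h => act h g (fun g' => rA a (fun h' a' =>
    phi (cj (Sinv h') y :: g') (x0 :: a'))))); last by lin.
  apply: eq_bsum => h0 h1.
  transitivity (DS h1 (fun u v => act h0 g (fun g' => rA a (fun h' a' =>
    phi (cj (Sinv h' * (Sinv v * u)) y :: g') (x0 :: a'))))).
    apply: eq_bsum => u v; apply: eq_act => g' _; apply: eq_bsum => h' a'.
    by rewrite SinvM -cjM mulrA.
  rewrite (DS_Sinvl (f := fun w => act h0 g (fun g' => rA a (fun h' a' =>
    phi (cj (Sinv h' * w) y :: g') (x0 :: a'))))); last by lin.
  by congr (_ *: _); apply: eq_act => g' _; apply: eq_bsum => h' a'; rewrite mulr1.
rewrite HT_rcons rA_rcons.
transitivity (RS x (fun h x0 => RS x0 (fun h2 x1 => DS h2 (fun h0 h1 => act h1 g (fun g' =>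
   rA a (fun h' a' => phi (cj (h0 * Sinv (h' * h)) y :: g') (x1 :: a'))))))); last first.
  rewrite bsumC; apply: eq_bsum => h x0.
  under [RHS]eq_bsum => h' a' do rewrite VT_rcons.
  rewrite [RHS]bsumC; apply: eq_bsum => h2 x1.
  rewrite [RHS]bsumC; apply: eq_bsum => h0 h1; rewrite act_bsum; apply: eq_bsum => h' a'.
  by apply: eq_act => g' _; rewrite cjM.
rewrite RS_assoc; [|by lin..].
apply: eq_bsum => h x0.
rewrite -DS_assoc; [|by lin..].
rewrite -(DS_counitl (f := fun h => act h g (fun g' => rA a (fun h' a' =>
  phi (cj (Sinv h') y :: g') (x0 :: a'))))); last by lin.
apply: eq_bsum => h0 h1.
symmetry; transitivity (DS h0 (fun u v => act h1 g (fun g' => rA a (fun h' a' =>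
  phi (cj (v * Sinv u * Sinv h') y :: g') (x0 :: a'))))).
  apply: eq_bsum => u v; apply: eq_act => g' _; apply: eq_bsum => h' a'.
  by rewrite SinvM mulrA.
rewrite (DS_Sinvr (f := fun w => act h1 g (fun g' => rA a (fun h' a' =>
  phi (cj (w * Sinv h') y :: g') (x0 :: a'))))); last by lin.
by congr (_ *: _); apply: eq_act => g' _; apply: eq_bsum => h' a'; rewrite mul1r.
Qed.

End Relations.

Lemma VS_VT_VF M (phi : seq H -> seq A -> M) g a i : mlin phi -> size a = i.+1 ->
  VS i (VT (VF 0 phi)) g a = phi g a.
Proof.
move=> pl; case: a => // x a sa; rewrite /VS ins1_last //.
by rewrite VT_1 ?VFE ?face0 ?mul1r //; apply: mlin_VF.
Qed.

Lemma VT_VS0 M (phi : seq H -> seq A -> M) g a i : mlin phi -> size a = i.+1 ->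
  VT (VS 0 phi) g a = VS i (VT (VT phi)) g a.
Proof.
move=> pl sa; rewrite [RHS]/VS ins1_last // VT_1; last exact: mlin_VT.
case/lastP: a sa => [//|a x] _; rewrite -rcons_cons !VT_rcons.
by apply: eq_bsum => h x0; apply: eq_act => g' _; rewrite /VS ins1S ins1_0.
Qed.

Lemma HS_HT_HF M (phi : seq H -> seq A -> M) g a i : mlin phi -> size g = i.+1 ->
  HS i (HT (HF 0 phi)) g a = phi g a.
Proof.
move=> pl; case: g => // x g sg; rewrite /HS ins1_last //.
by rewrite HT_1 ?HFE ?face0 ?mul1r //; apply: mlin_HF.
Qed.

Lemma HT_HS0 M (phi : seq H -> seq A -> M) g a i : mlin phi -> size g = i.+1 ->
  HT (HS 0 phi) g a = HS i (HT (HT phi)) g a.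
Proof.
move=> pl sg; rewrite [RHS]/HS ins1_last // HT_1; last exact: mlin_HT.
case/lastP: g sg => [//|g x] _; rewrite -rcons_cons !HT_rcons.
by apply: eq_bsum => h a'; rewrite /HS ins1S ins1_0.
Qed.

(** * Iterates of the cyclic operators and the cylindrical identity *)

(** Rotating an arbitrary final block makes the induction possible. Entries are coacted on from
    right to left, and each later factor multiplies on the left, which reproduces the product taken
    by [rho_all]. *)
Lemma VT_iter M (phi : seq H -> seq A -> M) g a b : mlin phi ->
  iter (size b) (@VT M) phi g (a ++ b) =
  rA b (fun h b' => act h g (fun g' => phi g' (b' ++ a))).
Proof.
elim: b a phi => [|x b ih] a phi pl.
  by case: pl => p1 _; rewrite cats0 rA_nil act_1 //; lin.
rewrite [size _]/= iterSr -cat_rcons ih; last exact: mlin_VT.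
case: pl => p1 p2; rewrite rA_cons.
transitivity (rA b (fun h b' => RS x (fun k x0 => act (k * h) g (fun g' => phi g' (x0 :: b' ++ a))))).
  apply: eq_bsum => h b'; under eq_act => g' _ do rewrite -rcons_cat VT_rcons.
  by rewrite act_bsum; apply: eq_bsum => k' x0; rewrite act_M //; lin.
exact: bsumC.
Qed.

(** Every rotation coacts anew on all of [a], and [rA_assoc] turns the repeated coactions into legs
    of one [h]. The last entry of [u] moves first and takes the earliest leg, so the first entry
    takes the final one, as in [actV]. *)
Lemma HT_iter M (phi : seq H -> seq A -> M) g u a : mlin phi ->
  iter (size u) (@HT M) phi (g ++ u) a =
  rA a (fun h a' => actV h u (fun u' => phi (u' ++ g) a')).
Proof.
elim: u g phi => [|x u ih] g phi pl.
  by case: pl => _ p2; rewrite cats0 /= rA_counit.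
rewrite [size _]/= iterSr -cat_rcons ih; last exact: mlin_HT.
case: pl => p1 p2.
transitivity (rA a (fun h a' => rA a' (fun h' a'' => actV h u (fun u' =>
    phi (cj (Sinv h') x :: u' ++ g) a'')))).
  apply: eq_bsum => h a'; rewrite -actV_bsum; apply: eq_actV => u' _.
  by rewrite -rcons_cat HT_rcons.
by rewrite rA_assoc; [|by lin..].
Qed.

(** The vertical turn comes first and acts by [h]; the horizontal turn then coacts on the components
    already produced, so coassociativity replaces the pair by h^(0) and S^{-1}(h^(1)), to which
    [actV_act] applies. *)
Lemma VT_HT_iter M (phi : seq H -> seq A -> M) g a : mlin phi ->
  iter (size a) (@VT M) (iter (size g) (@HT M) phi) g a = phi g a.
Proof.
move=> pl; have pm n : mlin (iter n (@HT M) phi) by elim: n => //= n; apply: mlin_HT.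
rewrite -[a in LHS]cat0s VT_iter //; case: (pl) => p1 p2.
transitivity (rA a (fun h a' => rA a' (fun h' a'' => act h g (fun g' =>
    actV h' g' (fun u => phi u a''))))).
  apply: eq_bsum => h a'; rewrite -act_bsum; apply: eq_act => g' sg'.
  rewrite cats0 -sg' -[g' in LHS]cat0s HT_iter //; apply: eq_bsum => h' a''.
  by apply: eq_actV => u _; rewrite cats0.
rewrite rA_assoc; [|by lin..].
rewrite -(rA_counit a (p2 g)); apply: eq_bsum => h a'.
exact: actV_act.
Qed.

(** * Assembly of the para-cyclic structures and the cylindrical module *)

Definition bideg p q := Obj (cvl p q) (@ceqv k H A p q).

Lemma good_bideg p q : good (bideg p q).
Proof.
split=> [l|l1 l2|l1 l2 l3] //= e; rewrite /ceqv /teq.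
  by move=> M phi pm; rewrite e.
by move=> e' M phi pm; rewrite e // e'.
Qed.

Lemma hpara q : paracyclic (@sclfs k H A) (fun p => vld (bideg p q)) (fun p => equ (bideg p q))
  (fun p i => hd p q i) (fun p i => hs p q i) (fun p => ht p q).
Proof.
apply: paracyclicI.
- by move=> p; apply: good_bideg.
- by move=> p; apply: cvalid_cat.
- by move=> p; apply: cvalid_scl.
- by move=> p i ip; apply: linmap_rep (rep_HF q ip).
- by move=> p i _; apply: linmap_rep (rep_HS p q i).
- by move=> p; apply: linmap_rep (rep_HT p q).
- by move=> p; apply: hd_last.
- move=> n i j ij; apply: (eqmap_rep (rep_comp (rep_HF _ _) (rep_HF _ _)) (rep_comp (rep_HF _ _) (rep_HF _ _))); try lia.
  by move=> M phi g a pl sg sa; apply: HF_HF; lia.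
- move=> n i j ij; apply: (eqmap_rep (rep_comp (rep_HS _ _ _) (rep_HS _ _ _)) (rep_comp (rep_HS _ _ _) (rep_HS _ _ _))); try lia.
  by move=> M phi g a pl sg sa; apply: HS_HS; lia.
- move=> n i j ij; apply: (eqmap_rep (rep_comp (rep_HF _ _) (rep_HS _ _ _)) (rep_comp (rep_HS _ _ _) (rep_HF _ _))); try lia.
  by move=> M phi g a pl sg sa; apply: HS_HF_lt; lia.
- move=> n j jn; apply: (eqmap_rep (rep_comp (rep_HF _ _) (rep_HS _ _ _)) (rep_id _ _)); try lia.
  by move=> M phi g a pl sg sa; apply: HS_HF; lia.
- move=> n j jn; apply: (eqmap_rep (rep_comp (rep_HF _ _) (rep_HS _ _ _)) (rep_id _ _)); try lia.
  by move=> M phi g a pl sg sa; apply: HS_HFS; lia.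
- move=> n; apply: (eqmap_rep (rep_comp (rep_HF _ _) (rep_comp (rep_HT _ _) (rep_HS _ _ _))) (rep_id _ _)); try lia.
  by move=> M phi g a pl sg sa; exact: HS_HT_HF.
- move=> n i j ij; apply: (eqmap_rep (rep_comp (rep_HF _ _) (rep_HS _ _ _)) (rep_comp (rep_HS _ _ _) (rep_HF _ _))); try lia.
  by move=> M phi g a pl sg sa; apply: HS_HF_gt; lia.
- move=> n i ij; apply: (eqmap_rep (rep_comp (rep_HF _ _) (rep_HT _ _)) (rep_comp (rep_HT _ _) (rep_HF _ _))); try lia.
  by move=> M phi g a pl sg sa; apply: HT_HF; lia.
- move=> n; apply: (eqmap_rep (rep_comp (rep_HF _ _) (rep_comp (rep_HT _ _) (rep_HT _ _))) (rep_comp (rep_HT _ _) (rep_HF _ _))); try lia.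
  by move=> M phi g a pl sg sa; apply: HT_HF_last.
- move=> n i ij; apply: (eqmap_rep (rep_comp (rep_HS _ _ _) (rep_HT _ _)) (rep_comp (rep_HT _ _) (rep_HS _ _ _))); try lia.
  by move=> M phi g a pl sg sa; apply: HT_HS; lia.
- move=> n; apply: (eqmap_rep (rep_comp (rep_HS _ _ _) (rep_HT _ _)) (rep_comp (rep_HT _ _) (rep_comp (rep_HT _ _) (rep_HS _ _ _)))); try lia.
  by move=> M phi g a pl sg sa; apply: HT_HS0.
Qed.

Lemma vpara p : paracyclic (@sclfs k H A) (fun q => vld (bideg p q)) (fun q => equ (bideg p q))
  (vd p) (vs p) (vt p).
Proof.
apply: paracyclicI.
- by move=> q; apply: good_bideg.
- by move=> q; apply: cvalid_cat.
- by move=> q; apply: cvalid_scl.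
- by move=> q i iq; apply: linmap_rep (rep_VF p iq).
- by move=> q i _; apply: linmap_rep (rep_VS p q i).
- by move=> q; apply: linmap_rep (rep_VT p q).
- by move=> q; apply: vd_last.
- move=> n i j ij; apply: (eqmap_rep (rep_comp (rep_VF _ _) (rep_VF _ _)) (rep_comp (rep_VF _ _) (rep_VF _ _))); try lia.
  by move=> M phi g a pl sg sa; apply: VF_VF; lia.
- move=> n i j ij; apply: (eqmap_rep (rep_comp (rep_VS _ _ _) (rep_VS _ _ _)) (rep_comp (rep_VS _ _ _) (rep_VS _ _ _))); try lia.
  by move=> M phi g a pl sg sa; apply: VS_VS; lia.
- move=> n i j ij; apply: (eqmap_rep (rep_comp (rep_VF _ _) (rep_VS _ _ _)) (rep_comp (rep_VS _ _ _) (rep_VF _ _))); try lia.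
  by move=> M phi g a pl sg sa; apply: VS_VF_lt; lia.
- move=> n j jn; apply: (eqmap_rep (rep_comp (rep_VF _ _) (rep_VS _ _ _)) (rep_id _ _)); try lia.
  by move=> M phi g a pl sg sa; apply: VS_VF; lia.
- move=> n j jn; apply: (eqmap_rep (rep_comp (rep_VF _ _) (rep_VS _ _ _)) (rep_id _ _)); try lia.
  by move=> M phi g a pl sg sa; apply: VS_VFS; lia.
- move=> n; apply: (eqmap_rep (rep_comp (rep_VF _ _) (rep_comp (rep_VT _ _) (rep_VS _ _ _))) (rep_id _ _)); try lia.
  by move=> M phi g a pl sg sa; exact: VS_VT_VF.
- move=> n i j ij; apply: (eqmap_rep (rep_comp (rep_VF _ _) (rep_VS _ _ _)) (rep_comp (rep_VS _ _ _) (rep_VF _ _))); try lia.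
  by move=> M phi g a pl sg sa; apply: VS_VF_gt; lia.
- move=> n i ij; apply: (eqmap_rep (rep_comp (rep_VF _ _) (rep_VT _ _)) (rep_comp (rep_VT _ _) (rep_VF _ _))); try lia.
  by move=> M phi g a pl sg sa; apply: VT_VF; lia.
- move=> n; apply: (eqmap_rep (rep_comp (rep_VF _ _) (rep_comp (rep_VT _ _) (rep_VT _ _))) (rep_comp (rep_VT _ _) (rep_VF _ _))); try lia.
  by move=> M phi g a pl sg sa; apply: VT_VF_last.
- move=> n i ij; apply: (eqmap_rep (rep_comp (rep_VS _ _ _) (rep_VT _ _)) (rep_comp (rep_VT _ _) (rep_VS _ _ _))); try lia.
  by move=> M phi g a pl sg sa; apply: VT_VS; lia.
- move=> n; apply: (eqmap_rep (rep_comp (rep_VS _ _ _) (rep_VT _ _)) (rep_comp (rep_VT _ _) (rep_comp (rep_VT _ _) (rep_VS _ _ _)))); try lia.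
  by move=> M phi g a pl sg sa; apply: VT_VS0.
Qed.

Lemma cylindrical_bideg : cylindrical (@sclfs k H A) (@cvalid k H A) (@ceqv k H A)
  hd hs ht vd vs vt.
Proof.
apply: (@cylindricalI _ _ _ bideg) => //.
- exact: good_bideg.
- exact: hpara.
- exact: vpara.
- by move=> p q; apply: hd_last.
- by move=> p q; apply: vd_last.
- move=> p q i j ip jq.
  apply: (eqmap_rep (rep_comp (rep_HF _ ip) (rep_VF _ jq)) (rep_comp (rep_VF _ jq) (rep_HF _ ip))).
  (* Interior faces in the two directions touch different lists, so only the order of the two range
     tests differs. *)
  by move=> M phi g a pl sg sa; rewrite /VF /HF; case: ifP; case: ifP.
- move=> p q i j ip jq.
  apply: (eqmap_rep (rep_comp (rep_HF _ ip) (rep_VS _ _ j)) (rep_comp (rep_VS _ _ j) (rep_HF _ ip))).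
  by [].
- move=> p q i ip.
  apply: (eqmap_rep (rep_comp (rep_HF _ ip) (rep_VT _ _)) (rep_comp (rep_VT _ _) (rep_HF _ ip))).
  by move=> M phi g a pl sg sa; apply: VT_HF => //; rewrite sg.
- move=> p q i j ip jq.
  apply: (eqmap_rep (rep_comp (rep_HS _ _ i) (rep_VF _ jq)) (rep_comp (rep_VF _ jq) (rep_HS _ _ i))).
  by [].
- move=> p q i j ip jq.
  by apply: (eqmap_rep (rep_comp (rep_HS _ _ i) (rep_VS _ _ j)) (rep_comp (rep_VS _ _ j) (rep_HS _ _ i))).
- move=> p q i ip.
  apply: (eqmap_rep (rep_comp (rep_HS _ _ i) (rep_VT _ _)) (rep_comp (rep_VT _ _) (rep_HS _ _ i))).
  by move=> M phi g a pl sg sa; apply: VT_HS.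
- move=> p q j jq.
  apply: (eqmap_rep (rep_comp (rep_HT _ _) (rep_VF _ jq)) (rep_comp (rep_VF _ jq) (rep_HT _ _))).
  by move=> M phi g a pl sg sa; rewrite HT_VF // sa.
- move=> p q j jq.
  apply: (eqmap_rep (rep_comp (rep_HT _ _) (rep_VS _ _ j)) (rep_comp (rep_VS _ _ j) (rep_HT _ _))).
  by move=> M phi g a pl sg sa; rewrite HT_VS.
- move=> p q.
  apply: (eqmap_rep (rep_comp (rep_HT _ _) (rep_VT _ _)) (rep_comp (rep_VT _ _) (rep_HT _ _))).
  by move=> M phi g a pl sg sa; apply: VT_HT; rewrite ?sg ?sa.
- move=> p q.
  apply: (eqmap_rep (rep_comp (rep_iter p.+1 (rep_HT _ _)) (rep_iter q.+1 (rep_VT _ _))) (rep_id _ _)).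
  by move=> M phi g a pl sg sa; rewrite -sg -sa VT_HT_iter.
Qed.

End Hopf.

Theorem theorem2p1 (k : comPzRingType) (H A : algType k)
  (Delta : H -> seq (H * H)) (eps : H -> k) (S Sinv : H -> H)
  (rho : A -> seq (H * A)) :
  @is_hopf_bijS k H A Delta eps S Sinv ->
  @is_comodule_algebra k H A Delta eps rho ->
  cylindrical (@sclfs k H A) (@cvalid k H A) (@ceqv k H A)
    (@chd k H A Delta S Sinv rho) (@chs k H A) (@cht k H A Delta S Sinv rho)
    (@cvd k H A Delta S rho) (@cvs k H A) (@cvt k H A Delta S rho).
Proof. by move=> hopf coma; apply: (cylindrical_bideg hopf coma). Qed.
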